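(* Let $\mathbb{K}$, $\mathcal{S}$, $V_1^L,V_2^L$ and ${\rm mult}(\mathscr{B}(\mathcal{S}))$ be as in the context. For every projective transformation $L$ of $\mathbb{P}^2(\mathbb{K})$, $${\rm mult}(\mathscr{B}(\mathcal{S}))=\deg_{\overline t}\Big({\rm Content}_{\{\overline x,\overline y\}}\big({\rm Res}_{t_3}(V_1^L,V_2^L)\big)\Big).$$
   Context: $\mathbb{K}$ is an algebraically closed field of characteristic zero. $\mathcal{S}=(s_1:s_2:s_3):\mathbb{P}^2(\mathbb{K})\dashrightarrow\mathbb{P}^2(\mathbb{K})$ is a dominant rational map, $s_i\in\mathbb{K}[t_1,t_2,t_3]$ homogeneous of the same degree, $\gcd(s_1,s_2,s_3)=1$, and $s_i(0,0,1)\neq0$ for $i=1,2,3$. $\mathscr{B}(\mathcal{S})$ is the set of common zeros of $s_1,s_2,s_3$ in $\mathbb{P}^2(\mathbb{K})$. With indeterminates $\overline x=(x_1,x_2,x_3)$, $\overline y=(y_1,y_2,y_3)$ and $\mathbb{F}$ the algebraic closure of $\mathbb{K}(\overline x,\overline y)$, let $V_1=\sum x_is_i$, $V_2=\sum y_is_i$ and ${\rm mult}(\mathscr{B}(\mathcal{S}))=\sum_{A\in\mathscr{B}(\mathcal{S})}{\rm mult}_A(\mathscr{C}(V_1),\mathscr{C}(V_2))$ (intersection multiplicities of the plane curves in $\mathbb{P}^2(\mathbb{F})$). For a projective transformation $L=(L_1:L_2:L_3)$ of $\mathbb{P}^2(\mathbb{K})$, $V_1^L=\sum_i x_iL_i(s_1,s_2,s_3)$,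 $V_2^L=\sum_i y_iL_i(s_1,s_2,s_3)$. ${\rm Res}_{t_3}$ is the resultant w.r.t. $t_3$; ${\rm Content}_{\{\overline x,\overline y\}}(R)$ is the gcd in $\mathbb{K}[t_1,t_2]$ of the coefficients of $R$ as a polynomial in $\overline x,\overline y$ (up to a nonzero constant); $\deg_{\overline t}$ is the degree in $t_1,t_2$. *)

(* Defs.v *)
From HB Require Import structures.
From mathcomp Require Import all_boot all_order all_algebra.
From mathcomp Require Import mpoly.
From Stdlib Require Import ClassicalEpsilon.

Set Implicit Arguments.
Unset Strict Implicit.
Unset Printing Implicit Defensive.

Import GRing.Theory.
Local Open Scope ring_scope.

Definition mdvd {n : nat} {R : nzRingType} (p q : {mpoly R[n]}) : Prop :=
  exists r : {mpoly R[n]}, q = p * r.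

Definition mcoprime3 {K : fieldType} (s : 'I_3 -> {mpoly K[3]}) : Prop :=
  forall p : {mpoly K[3]}, (forall i, mdvd p (s i)) -> (msize p <= 1)%N.

(* Points of P^2 are represented by nonzero vectors of K^3. *)
Definition nonzero3 {K : nzRingType} (t : 'I_3 -> K) : Prop := exists i, t i != 0.

Definition proportional3 {K : nzRingType} (u v : 'I_3 -> K) : Prop :=
  exists c : K, forall i, u i = c * v i.

Definition e3 {K : nzRingType} : 'I_3 -> K := fun i => (val i == 2%N)%:R.

Definition is_base_point {K : fieldType} (s : 'I_3 -> {mpoly K[3]})
  (t : 'I_3 -> K) : Prop :=
  nonzero3 t /\ forall i, (s i).@[t] = 0.

(* The rational map S : P^2 --> P^2 is dominant: its image (over the
   domain of definition P^2 \ B(S)) is Zariski dense, i.e. the only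
   homogeneous polynomial vanishing on the image is 0. *)
Definition dominant {K : fieldType} (s : 'I_3 -> {mpoly K[3]}) : Prop :=
  forall G : {mpoly K[3]}, (exists e, G \is e.-homog) ->
    (forall t : 'I_3 -> K, nonzero3 t -> ~ is_base_point s t ->
        G.@[fun i => (s i).@[t]] = 0) ->
    G = 0.

Definition base_points_reps {K : fieldType} (s : 'I_3 -> {mpoly K[3]})
  (l : seq ('I_3 -> K)) : Prop :=
  (forall i : nat, (i < size l)%N -> is_base_point s (nth (fun _ => 0) l i)) /\
  (forall i j : nat, (i < size l)%N -> (j < size l)%N -> i <> j ->
      ~ proportional3 (nth (fun _ => 0) l i) (nth (fun _ => 0) l j)) /\
  (forall t, is_base_point s t ->
      exists2 i : nat, (i < size l)%N & proportional3 t (nth (fun _ => 0) l i)).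

(* For homogeneous f, g in F[t1,t2,t3] and a point A of P^2(F),
   mult_A(f,g) = dim_F O_A / (f,g) O_A, where O_A is the local ring of P^2 at A
   (fractions N/D, N, D homogeneous of the same degree, D(A) <> 0), and
   (f,g)O_A is the ideal generated by f, g (dehomogenized).  An element N/D
   of O_A lies in that ideal iff W*N is in the ideal (f,g) of F[t1,t2,t3] for
   some homogeneous W with W(A) <> 0.
   loc_indep ... k N D : the k fractions N_i/D_i are elements of O_A that are
   linearly independent modulo (f,g)O_A. *)
Definition loc_indep {F : fieldType} (f g : {mpoly F[3]}) (A : 'I_3 -> F)
  (k : nat) (N D : 'I_k -> {mpoly F[3]}) : Prop :=
  (forall i, exists e, N i \is e.-homog /\ D i \is e.-homog) /\
  (forall i, (D i).@[A] != 0) /\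
  (forall c : 'I_k -> F,
     (exists W a b : {mpoly F[3]}, (exists e, W \is e.-homog) /\ W.@[A] != 0 /\
        W * (\sum_(i < k) c i *: (N i * \prod_(j < k | j != i) D j))
          = a * f + b * g) ->
     forall i, c i = 0).

Definition has_indep_family {F : fieldType} (f g : {mpoly F[3]})
  (A : 'I_3 -> F) (k : nat) : Prop :=
  exists N D : 'I_k -> {mpoly F[3]}, loc_indep f g A N D.

(* mult_A(f,g) = the dimension, i.e. the largest k admitting an independent
   family of size k (junk value if the dimension is infinite, which does not
   happen in the situation of the theorem). *)
Definition imult {F : fieldType} (f g : {mpoly F[3]}) (A : 'I_3 -> F) : nat :=
  epsilon (inhabits 0%N)
    (fun k => has_indep_family f g A k /\
              forall k', has_indep_family f g A k' -> (k' <= k)%N).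

(* x_1,x_2,x_3,y_1,y_2,y_3 are z_0,..,z_5 : elements of F algebraically
   independent over (the image of) K. *)
Definition alg_indep {K F : fieldType} (iota : {rmorphism K -> F})
  (z : 'I_6 -> F) : Prop :=
  forall p : {mpoly K[6]}, mmap iota z p = 0 -> p = 0.

Definition Vcurve {K F : fieldType} (iota : {rmorphism K -> F})
  (z : 'I_6 -> F) (s : 'I_3 -> {mpoly K[3]}) (j : bool) : {mpoly F[3]} :=
  \sum_(i < 3) (z (if j then rshift 3 i else lshift 3 i))%:MP
                * map_mpoly iota (s i).

(* The ring K[t1,t2][x1,x2,x3,y1,y2,y3][t3]. *)
Definition RT (K : fieldType) := {poly {mpoly {mpoly K[2]}[6]}}.

Definition cK {K : fieldType} (c : K) : RT K := ((c%:MP)%:MP)%:P.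

Definition toRT {K : fieldType} (s : {mpoly K[3]}) : RT K :=
  mmap (@cK K)
    (fun i : 'I_3 => match val i with
                     | 0%N => ((('X_ord0 : {mpoly K[2]})%:MP) : {mpoly {mpoly K[2]}[6]})%:P
                     | 1%N => ((('X_(inord 1) : {mpoly K[2]})%:MP) : {mpoly {mpoly K[2]}[6]})%:P
                     | _ => 'X
                     end) s.

(* L = (L_1:L_2:L_3) with L_i(u) = sum_j M i j u_j, M invertible.
   V^L = sum_i x_i L_i(s_1,s_2,s_3) (j = false), resp. with y_i (j = true). *)
Definition VL {K : fieldType} (s : 'I_3 -> {mpoly K[3]}) (M : 'M[K]_3)
  (j : bool) : RT K :=
  \sum_(i < 3)
     (('X_(if j then rshift 3 i else lshift 3 i) : {mpoly {mpoly K[2]}[6]})%:P)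
     * \sum_(k < 3) cK (M i k) * toRT (s k).

Definition is_content {K : fieldType} (R : {mpoly {mpoly K[2]}[6]})
  (C : {mpoly K[2]}) : Prop :=
  (forall m, mdvd C (R@_m)) /\
  (forall D : {mpoly K[2]}, (forall m, mdvd D (R@_m)) -> mdvd D C).

Definition deg_t {K : fieldType} (C : {mpoly K[2]}) : nat := (msize C).-1.

(* Main.v *)
Require Import Defs.
From HB Require Import structures.
From mathcomp Require Import all_boot all_order all_algebra.
From mathcomp Require Import perm mpoly.
From mathcomp Require Import ring zify.
From Stdlib Require Import Classical ClassicalEpsilon.

(* Fix (a:b) in P^1(K) and coordinates (u, T) around the line through (0:0:1)
   and (a:b:0).  The two curves become polynomials f, g in F[u][T] whose leading
   coefficients in T are nonzero constants, so F[u,T]/(f,g) is the cokernel over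
   F[u] of the Sylvester matrix.  As long as the determinant vanishes at u = 0, an
   eigenvector of T on the left kernel of the matrix at u = 0 enlarges the ideal
   by one dimension, supported at a point (0, tau), and divides the determinant by
   u.  Hence the order at u = 0 of the resultant is the sum over tau of the local
   multiplicities at (a:b:tau).

   A common zero (a:b:tau) over F of the two generic combinations is a base point
   with tau in K: otherwise the resultant of the generic combinations of the
   s_i(a,b,T), with their common factor removed, would vanish at algebraically
   independent elements, hence identically, but some specialization of it does
   not.  So on fibres over K the multiplicities count base points only.

   Finally Res = C * R' with C homogeneous and R' not vanishing identically in x, y
   over any (a:b) in P^1(K), so the orders of Res along those fibres are the
   multiplicities of the linear factors of C, and they add up to deg C.  The
   matrix L is absorbed by a linear change of the indeterminates x, y. *)

Set Implicit Arguments.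
Unset Strict Implicit.
Unset Printing Implicit Defensive.

Import GRing.Theory.
Local Open Scope ring_scope.

(** * Dimensions of localized quotients *)

Section LocalAlgebra.

Variable F : closedFieldType.
Local Notation R := {poly {poly F}}.
Implicit Types (I : R -> Prop) (t : F).

(** The value at the point [(u, T) = (0, t)], where [u] is the inner variable and [T] the outer
    one. *)
Definition ev0 t : R -> F := horner_eval 0 \o horner_eval t%:P.
HB.instance Definition _ t := GRing.RMorphism.on (ev0 t).

Lemma ev0C t (c : {poly F}) : ev0 t c%:P = c.[0].
Proof. by rewrite /ev0 /= /horner_eval hornerC. Qed.

Lemma ev0X t : ev0 t 'X = t.
Proof. by rewrite /ev0 /= /horner_eval hornerX hornerC. Qed.

(** The maximal ideal of the point [(0, t)] is generated by [u] and [T - t]: divide by [T - t], then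
    divide the remainder by [u]. *)
Lemma ev0_decomp t (w : R) :
  exists w1 w2, w = (ev0 t w)%:P%:P + w1 * 'X%:P + w2 * ('X - t%:P%:P).
Proof.
have /factor_theorem[w2 Dw2] : root (w - w.[t%:P]%:P) t%:P.
  by rewrite /root hornerD hornerN hornerC subrr.
have /factor_theorem[w1 Dw1] : root (w.[t%:P] - (w.[t%:P].[0])%:P) 0.
  by rewrite /root hornerD hornerN hornerC subrr.
exists w1%:P, w2; rewrite -Dw2 -polyCM.
move: Dw1; rewrite polyC0 subr0 => <-.
by rewrite polyCB /ev0 /= /horner_eval; ring.
Qed.

Definition ideal I :=
  [/\ I 0, forall p q, I p -> I q -> I (p + q) & forall p q, I q -> I (p * q)].

Lemma ideal_sum I (J : Type) (r : seq J) (P : pred J) (f : J -> R) :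
  ideal I -> (forall j, P j -> I (f j)) -> I (\sum_(j <- r | P j) f j).
Proof. by case=> I0 ID _ If; elim/big_ind: _. Qed.

(* The contraction to F[u,T] of the ideal generated by I in the local ring at
   (u, T) = (0, t). *)
Definition loc I t (p : R) := exists2 w, ev0 t w != 0 & I (w * p).

Lemma loc_ideal I t : ideal I -> ideal (loc I t).
Proof.
case=> I0 ID IM; split.
- by exists 1; rewrite ?rmorph1 ?oner_eq0 // mulr0.
- move=> p q [w w0 Iw] [x x0 Ix]; exists (w * x).
    by rewrite rmorphM mulf_neq0.
  rewrite mulrDr; apply: (ID); last by rewrite -mulrA; apply: (IM).
  by rewrite (mulrC w) -mulrA; apply: (IM).
by move=> p q [w w0 Iw]; exists w => //; rewrite mulrCA; apply: (IM).
Qed.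

Lemma loc_sub I t p : I p -> loc I t p.
Proof. by exists 1; rewrite ?rmorph1 ?oner_eq0 // mul1r. Qed.

Definition lcomb k (c : 'I_k -> F) (e : 'I_k -> R) : R :=
  \sum_i (c i)%:P%:P * e i.

Definition loc_free I t k (e : 'I_k -> R) :=
  forall c, loc I t (lcomb c e) -> forall i, c i = 0.

Definition loc_basis I t k (e : 'I_k -> R) :=
  loc_free I t e /\ forall p, exists c, loc I t (p - lcomb c e).

Definition loc_dim I t k := exists e : 'I_k -> R, loc_basis I t e.

(** If [k] exceeded [k'], the matrix of coordinates of the [e i] in a basis would have more rows
    than columns. A nonzero vector of its left kernel would then be a nontrivial relation among the
    [e i]. *)
Lemma loc_free_leq I t k k' (e : 'I_k -> R) :
  ideal I -> loc_dim I t k' -> loc_free I t e -> (k <= k')%N.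
Proof.
move=> idI [e' [_ spane']] freee.
have [B DB] : exists B : 'I_k -> ('I_k' -> F),
    forall i, loc I t (e i - lcomb (B i) e').
  exact: (fin_all_exists (fun i => spane' (e i))).
rewrite leqNgt; apply/negP => ltk.
pose A : 'M[F]_(k, k') := \matrix_(i, j) B i j.
have : kermx A != 0.
  by rewrite kermx_eq0 /row_free neq_ltn (leq_ltn_trans (rank_leq_col A)).
case/rowV0Pn => v /sub_kermxP vA0 v0.
case/negP: v0; apply/eqP/rowP => i; rewrite mxE.
apply: (freee (v 0)).
have [L0 LD LM] := loc_ideal t idI.
suff ->: lcomb (v 0) e = \sum_i (v 0 i)%:P%:P * (e i - lcomb (B i) e').
  by apply: (ideal_sum _ (loc_ideal t idI)) => j _; apply: (LM).
under [RHS]eq_bigr do rewrite mulrBr.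
rewrite sumrB -[LHS]subr0; congr (_ - _).
rewrite /lcomb; under [RHS]eq_bigr do rewrite mulr_sumr.
rewrite exchange_big big1 //= => j _.
under eq_bigr do rewrite mulrA -!polyCM.
rewrite -mulr_suml -!rmorph_sum.
have := congr1 (fun M : 'rV_k' => M 0 j) vA0; rewrite !mxE.
by under eq_bigr do rewrite mxE; move=> sB0; rewrite sB0 !rmorph0 mul0r.
Qed.

Section Extension.

Variables (I : R -> Prop) (p : R) (a : F).
Hypotheses (idI : ideal I) (nIp : ~ I p) (Iup : I ('X%:P * p))
  (Iap : I (('X - a%:P%:P) * p)).

(** Since [u] and [T - a] multiply [p] into [I], the ring acts on [p] modulo [I] through evaluation
    at [(0, a)]. The ideal generated by [I] and [p] is therefore only [I + F p]. *)
Definition adjoin (q : R) := exists c : F, I (q - c%:P%:P * p).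

Lemma ev0_mul_gen (w : R) : I (w * p - (ev0 a w)%:P%:P * p).
Proof.
have [I0 ID IM] := idI; have [w1 [w2 Dw]] := ev0_decomp a w.
have ->: w * p - (ev0 a w)%:P%:P * p = w1 * ('X%:P * p) + w2 * (('X - a%:P%:P) * p).
  by rewrite {1}Dw; ring.
by apply: (ID); apply: (IM).
Qed.

Lemma adjoin_sub q : I q -> adjoin q.
Proof. by exists 0; rewrite !polyC0 mul0r subr0. Qed.

Lemma adjoin_gen : adjoin p.
Proof. by have [I0 _ _] := idI; exists 1; rewrite !polyC1 mul1r subrr. Qed.

Lemma adjoin_ideal : ideal adjoin.
Proof.
have [I0 ID IM] := idI; split.
- exact: adjoin_sub.
- move=> q r [c Ic] [b Ib]; exists (c + b).
  rewrite !polyCD (_ : _ - _ = q - c%:P%:P * p + (r - b%:P%:P * p)); last by ring.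
  exact: ID.
move=> q r [c Ic]; exists (c * ev0 a q).
rewrite !polyCM (_ : _ - _ = q * (r - c%:P%:P * p) +
  c%:P%:P * (q * p - (ev0 a q)%:P%:P * p)); last by ring.
by apply: (ID); apply: (IM) => //; apply: ev0_mul_gen.
Qed.

(** The factor [T - a] is invertible at [(0, t)] and multiplies [p] into [I], so [p] already lies in
    the localization of [I] there. *)
Lemma loc_gen_neq t : t != a -> forall q, loc adjoin t q -> loc I t q.
Proof.
have [I0 ID IM] := idI => neq_ta q [w w0 [c Ic]].
exists (('X - a%:P%:P) * w).
  by rewrite rmorphM mulf_neq0 // rmorphB /= ev0X ev0C hornerC subr_eq0.
rewrite (_ : _ * q = ('X - a%:P%:P) * (w * q - c%:P%:P * p) +
  c%:P%:P * (('X - a%:P%:P) * p)); last by ring.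
by apply: (ID); apply: (IM).
Qed.

Lemma loc_adjoin_sub t q : loc I t q -> loc adjoin t q.
Proof. by case=> w w0 Iw; exists w => //; apply: adjoin_sub. Qed.

(** At [t = a] a basis modulo the larger ideal is completed by [p]. This [p] is locally nonzero:
    [w * p] equals [w(0, a) p] modulo [I], so [w * p] in [I] with [w(0, a)] nonzero would put [p] in
    [I]. *)
Lemma loc_dim_adjoin t k : loc_dim adjoin t k -> loc_dim I t ((a == t) + k).
Proof.
have [I0 ID IM] := idI.
case=> e [freee spane]; have [Dt|neq_ta] := eqVneq a t; last first.
  exists e; split=> [c Ic|q]; first by apply: freee; apply: loc_adjoin_sub.
  by have [c Hc] := spane q; exists c; apply: loc_gen_neq => //; rewrite eq_sym.
subst t; rewrite add1n.
have nlocp : ~ loc I a p.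
  case=> w w0 Iwp; apply: nIp.
  have -> : p = (ev0 a w)^-1%:P%:P * (w * p - (w * p - (ev0 a w)%:P%:P * p)).
    rewrite subKr mulrA -!polyCM mulVf // !polyC1 mul1r //.
  apply: (IM); apply: (ID) => //; rewrite -mulN1r; apply: (IM); exact: ev0_mul_gen.
pose e' (i : 'I_k.+1) := if unlift ord0 i is Some j then e j else p.
have De' c : lcomb c e' = (c ord0)%:P%:P * p + lcomb (fun j => c (lift ord0 j)) e.
  rewrite /lcomb big_ord_recl /e' unlift_none; congr (_ + _).
  by apply: eq_bigr => j _; rewrite liftK.
have [L0 LD LM] := loc_ideal a idI.
exists e'; split=> [c Ic|q].
  have c0 j : c (lift ord0 j) = 0.
    apply: (freee (fun j => c (lift ord0 j))).
    have -> : lcomb (fun j => c (lift ord0 j)) e = lcomb c e' - (c ord0)%:P%:P * p.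
      by rewrite De' addrC addKr.
    have [A0 AD AM] := loc_ideal a adjoin_ideal.
    apply: AD; first exact: loc_adjoin_sub.
    by rewrite -mulNr; apply: AM; apply: loc_sub; apply: adjoin_gen.
  have c00 : c ord0 = 0.
    apply/eqP/negP => /negP nz; apply: nlocp.
    have -> : p = (c ord0)^-1%:P%:P * lcomb c e'.
      rewrite De' /lcomb big1 => [|j _]; last by rewrite c0 !polyC0 mul0r.
      by rewrite addr0 mulrA -!polyCM mulVf // !polyC1 mul1r.
    exact: LM.
  by move=> i; case: (unliftP ord0 i) => [j|] ->.
have [c [w w0 [b Ib]]] := spane q.
(* Multiplication by [w] acts on [p] as the scalar [ev0 a w], so the coefficient [b / ev0 a w] of
   [p] cancels the remainder [b p]. *)
pose c' i := if unlift ord0 i is Some j then c j else b / ev0 a w.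
exists c'; exists w => //.
have -> : lcomb c' e' = (b / ev0 a w)%:P%:P * p + lcomb c e.
  rewrite De' /c' unlift_none; congr (_ + _).
  by apply: eq_bigr => j _; rewrite liftK.
have -> : w * (q - ((b / ev0 a w)%:P%:P * p + lcomb c e)) =
    w * (q - lcomb c e) - b%:P%:P * p -
    (b / ev0 a w)%:P%:P * (w * p - (ev0 a w)%:P%:P * p).
  have -> : b%:P%:P = (b / ev0 a w)%:P%:P * (ev0 a w)%:P%:P.
    by rewrite -!polyCM divfK.
  by ring.
apply: (ID) => //; rewrite -mulNr; apply: (IM); exact: ev0_mul_gen.
Qed.

End Extension.

Lemma loc_dim0 I t w : ideal I -> ev0 t w != 0 -> I w -> loc_dim I t 0.
Proof.
case=> I0 ID IM w0 Iw; exists (fun _ => 0); split=> [c _ []//|p].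
by exists (fun _ => 0); exists w => //; rewrite mulrC; apply: (IM).
Qed.

End LocalAlgebra.

(** * Composition chains of lattices *)

Section Chain.

Variable F : closedFieldType.
Local Notation R := {poly {poly F}}.

(** The left kernel of [A] is nonzero and stable under [B]. The matrix [X] of [B] in a basis [U] of
    this kernel has an eigenvalue because [F] is algebraically closed. *)
Lemma stable_kernel_eigenvector n (A B : 'M[F]_n) :
  \det A = 0 -> (forall v : 'rV_n, v *m A = 0 -> v *m B *m A = 0) ->
  exists (v : 'rV_n) a, [/\ v != 0, v *m A = 0 & v *m B = a *: v].
Proof.
move=> /eqP/det0P[v0 v0n v0A] stabB.
pose U := row_base (kermx A).
have UA : U *m A = 0 by apply/sub_kermxP; rewrite eq_row_base.
have [X DX] : exists X, U *m B = X *m U.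
  apply/submxP; rewrite eq_row_base; apply/sub_kermxP/row_matrixP => i.
  by rewrite row0 (row_mul i (U *m B)) (row_mul i U B) stabB // -(row_mul i U A) UA row0.
have rgt0 : (0 < \rank (kermx A))%N.
  by rewrite lt0n mxrank_eq0; apply/rowV0Pn; exists v0 => //; apply/sub_kermxP.
have [a] : exists a, root (char_poly X) a.
  apply/closed_rootP; rewrite size_char_poly.
  by case: (\rank _) rgt0.
rewrite -eigenvalue_root_char => /eigenvalueP[w wX w0].
exists (w *m U), a; split.
- by rewrite mulmx_free_eq0 // row_base_free.
- by rewrite -mulmxA UA mulmx0.
by rewrite -mulmxA DX mulmxA wX scalemxAl.
Qed.

Section Shift.

Variables (n : nat) (phi : R).
Hypotheses (phi_monic : phi \is monic) (size_phi : size phi = n.+2).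

(** Multiplication by [T] in [F[u][T]/(phi)], on coefficient rows: subtracting the top coefficient
    times the monic [phi] brings the degree back to at most [n]. *)
Definition shiftX (v : 'rV[{poly F}]_n.+1) : 'rV[{poly F}]_n.+1 :=
  poly_rV ('X * rVpoly v - (v 0 ord_max)%:P * phi).

Lemma rVpoly_shiftX v :
  rVpoly (shiftX v) = 'X * rVpoly v - (v 0 ord_max)%:P * phi.
Proof.
apply: poly_rV_K; apply/leq_sizeP => k ltnk.
rewrite coefB coefXM coefCM; case: k ltnk => // k; rewrite ltnS /= => lenk.
have [Dk|neqk] := eqVneq k n.
  rewrite Dk (_ : phi`_n.+1 = 1) ?mulr1; last first.
    by move/monicP: phi_monic; rewrite lead_coefE size_phi.
  by rewrite -[n in _`_n]/(val (@ord_max n)) coef_rVpoly_ord subrr.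
have ltnk: (n < k)%N by rewrite ltn_neqAle eq_sym neqk.
rewrite [phi`__]nth_default ?size_phi ?ltnS // mulr0 subr0.
by apply: nth_default; apply: leq_trans (size_poly _ _) _.
Qed.

Lemma shiftXZ c v : shiftX (c *: v) = c *: shiftX v.
Proof.
apply: (can_inj rVpolyK); rewrite rVpoly_shiftX !linearZ /= rVpoly_shiftX mxE.
by rewrite -!mul_polyC polyCM; ring.
Qed.

Lemma shiftXM k (v : 'rV_k) (A : 'M_(k, n.+1)) :
  shiftX (v *m A) = v *m \matrix_i shiftX (row i A).
Proof.
apply: (can_inj rVpolyK); rewrite rVpoly_shiftX !mulmx_sum_row !linear_sum /=.
rewrite summxE rmorph_sum /= mulr_sumr mulr_suml -sumrB.
apply: eq_bigr => i _; rewrite rowK !linearZ /= rVpoly_shiftX !mxE.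
by rewrite -!mul_polyC polyCM; ring.
Qed.

End Shift.

Definition row_replace n (i0 : 'I_n) (A : 'M[{poly F}]_n) (p : 'rV_n) : 'M_n :=
  \matrix_(i, j) if i == i0 then p 0 j else A i j.

Lemma row_row_replace n (i0 i : 'I_n) A p :
  row i (row_replace i0 A p) = if i == i0 then p else row i A.
Proof. by apply/rowP => j; rewrite !mxE; case: eqP; rewrite ?mxE. Qed.

(** Cramer's rule: expand along the replaced row, whose cofactors are those of [A]. *)
Lemma det_row_replace n (i0 : 'I_n) A p :
  \det (row_replace i0 A p) = (p *m \adj A) 0 i0.
Proof.
rewrite (expand_det_row _ i0) mxE; apply: eq_bigr => j _.
rewrite !mxE eqxx /cofactor; congr (_ * (_ * \det _)).
by apply/matrixP => i k; rewrite !mxE eq_sym (negPf (neq_lift _ _)).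
Qed.

Lemma map_mx_horner0 m n (A : 'M[{poly F}]_(m, n)) :
  map_mx (horner_eval 0) A = 0 -> exists B, A = 'X *: B.
Proof.
move=> A0; exists (\matrix_(i, j) (A i j %/ 'X)); apply/matrixP => i j.
rewrite !mxE mulrC divpK // -['X]subr0 -polyC0 -root_factor_theorem.
by apply/eqP; have := congr1 (fun M => fun_of_matrix M i j) A0; rewrite !mxE.
Qed.

(** Only elements of degree below [n] in [T] are described. Together with a monic element of degree
    [n] in [I], this presents the quotient by [I] as the cokernel of [A] over [F[u]]. *)
Definition row_span n (A : 'M[{poly F}]_n) (I : R -> Prop) :=
  forall v : 'rV_n, I (rVpoly v) <-> exists w, v = w *m A.

Lemma row_span_rows m n (A : 'M[{poly F}]_(m, n)) k (B : 'M_(k, n)) :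
  (forall i, exists w, row i A = w *m B) ->
  forall v : 'rV_m, exists w, v *m A = w *m B.
Proof.
move=> sAB v; rewrite mulmx_sum_row.
elim/big_ind: _ => [|x y [w ->] [w' ->]|i _]; first by exists 0; rewrite mul0mx.
  by exists (w + w'); rewrite mulmxDl.
by have [w ->] := sAB i; exists (v 0 i *: w); rewrite scalemxAl.
Qed.

(* Induction on m: let v be an eigenvector, with eigenvalue a, of T on the left
   kernel of A at u = 0.  Then p = v A / u satisfies u p, (T - a) p in I, and
   replacing a row of A by p divides the determinant by u. *)
Lemma composition_chain m n (phi : R) (A : 'M[{poly F}]_n) (I : R -> Prop) r :
    ideal I -> I phi -> phi \is monic -> size phi = n.+1 -> row_span A I ->
    \det A = 'X^m * r -> r.[0] != 0 ->
  exists2 ts : seq F, size ts = m & forall t, loc_dim I t (count_mem t ts).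
Proof.
elim: m n phi A I r => [|m IHm] n phi A I r idI Iphi phi_monic sz_phi spanA detA r0.
  exists [::] => // t; case: n => [|n] in sz_phi A spanA detA *.
    apply: (@loc_dim0 _ _ _ phi) => //.
    have -> : phi = 1.
      rewrite (size1_polyC (eq_leq sz_phi)); congr _%:P.
      by move/monicP: phi_monic; rewrite lead_coefE sz_phi.
    by rewrite rmorph1 oner_eq0.
  (* Multiplying by the adjugate shows that [\det A], which is [r] here, lies in [I]; it is
     invertible at [u = 0], so every local quotient is zero. *)
  apply: (@loc_dim0 _ _ _ r%:P) => //; first by rewrite ev0C.
  have -> : r%:P = rVpoly (r *: delta_mx 0 ord0 : 'rV_n.+1).
    by rewrite linearZ /= rVpoly_delta expr0 -mul_polyC mulr1.
  apply/spanA; exists (delta_mx 0 ord0 *m \adj A).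
  by rewrite -mulmxA mul_adj_mx detA expr0 mul1r mul_mx_scalar.
case: n => [|n] in sz_phi A spanA detA *.
  have := congr1 (horner_eval 0) detA.
  rewrite det_mx00 rmorphM rmorphXn /= /horner_eval hornerX hornerC.
  by rewrite expr0n mul0r => /eqP; rewrite oner_eq0.
pose ev := horner_eval (0 : F).
have [I0 ID IM] := idI.
have Irow i : I (rVpoly (row i A)).
  by apply/spanA; exists (delta_mx 0 i); rewrite rowE.
have [B DB] : exists B : 'M_n.+1, \matrix_i shiftX phi (row i A) = B *m A.
  have ex_i i : exists w, shiftX phi (row i A) = w *m A.
    apply/spanA; rewrite rVpoly_shiftX //; apply: (ID); first exact: IM.
    by rewrite -mulNr; apply: IM.
  have [w Dw] := fin_all_exists ex_i.
  exists (\matrix_i w i); apply/row_matrixP => i.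
  by rewrite row_mul !rowK.
have [v [a [v_neq0 vA vB]]] :
    exists (v : 'rV_n.+1) a, [/\ v != 0, v *m map_mx ev A = 0
                             & v *m map_mx ev B = a *: v].
  (* Stability of the kernel: if [v A] vanishes at [u = 0], then [v A = u p], and [v B A], being the
     shift of [v A], is [u] times the shift of [p]. *)
  apply: stable_kernel_eigenvector => [|v vA].
    rewrite det_map_mx /= detA rmorphM rmorphXn /= /ev /horner_eval hornerX.
    by rewrite expr0n mul0r.
  have Dv : v = map_mx ev (map_mx polyC v).
    by apply/matrixP => i j; rewrite !mxE /ev /horner_eval hornerC.
  have [p Dp] : exists p, map_mx polyC v *m A = 'X *: p.
    by apply: map_mx_horner0; rewrite map_mxM /= -/ev -Dv.
  rewrite Dv -!map_mxM /= -mulmxA -DB -shiftXM // Dp shiftXZ //.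
  by apply/matrixP => i j; rewrite !mxE /ev /horner_eval hornerM hornerX mul0r.
pose v' : 'rV[{poly F}]_n.+1 := map_mx polyC v.
have Dv : v = map_mx ev v'.
  by apply/matrixP => i j; rewrite !mxE /ev /horner_eval hornerC.
have [p Dp] : exists p, v' *m A = 'X *: p.
  by apply: map_mx_horner0; rewrite map_mxM /= -/ev -Dv.
have [q Dq] : exists q, v' *m B - a%:P *: v' = 'X *: q.
  apply: map_mx_horner0; rewrite map_mxB map_mxM /= -/ev -Dv vB.
  by apply/matrixP => i j; rewrite !mxE /ev /horner_eval hornerM !hornerC subrr.
have X0 : ('X : {poly F}) != 0 by rewrite polyX_eq0.
(* Cancel [u] in the equality of [u] times the shift of [p] with [v' B A = (a v' + u q) A]. *)
have shp : shiftX phi p = a%:P *: p + q *m A.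
  apply: (scalemx_inj X0); rewrite -shiftXZ // -Dp shiftXM // DB mulmxA.
  have -> : v' *m B = 'X *: q + a%:P *: v' by rewrite -Dq subrK.
  by rewrite mulmxDl -!scalemxAl Dp scalerDr !scalerA mulrC addrC.
have [i0 vi0] : exists i, v 0 i != 0 by apply/rV0Pn.
pose P := rVpoly p.
have IuP : I ('X%:P * P).
  by rewrite mul_polyC -linearZ /= -Dp; apply/spanA; exists v'.
have IaP : I (('X - a%:P%:P) * P).
  have -> : ('X - a%:P%:P) * P = rVpoly (q *m A) + (p 0 ord_max)%:P * phi.
    have := rVpoly_shiftX phi_monic sz_phi p.
    rewrite shp linearD linearZ /= -/P -mul_polyC => e.
    by rewrite mulrBl -(addKr (a%:P%:P * P) (rVpoly _)) e; ring.
  by apply: (ID); [apply/spanA; exists q | apply: IM].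
have detA0 : \det A != 0.
  rewrite detA mulf_neq0 ?expf_neq0 //.
  by apply: contraNneq r0 => ->; rewrite horner0.
(* If [p = w A], then [v' A = u w A], hence [v' = u w] because [\det A] is nonzero. At [u = 0] this
   contradicts [v 0 i0 != 0]. *)
have nIP : ~ I P.
  case/spanA=> w Dw; move/negP: vi0; apply.
  have /(congr1 (fun M => M *m \adj A)) : v' *m A = ('X *: w) *m A.
    by rewrite Dp Dw scalemxAl.
  rewrite -!mulmxA mul_mx_adj !mul_mx_scalar => /(scalemx_inj detA0)/rowP/(_ i0).
  rewrite !mxE => /(congr1 (horner_eval 0)).
  by rewrite /horner_eval hornerC hornerM hornerX mul0r => ->.
pose A' := row_replace i0 A p.
have p_in : exists w, p = w *m A'.
  by exists (delta_mx 0 i0); rewrite -rowE row_row_replace eqxx.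
have rowA i : exists w, row i A = w *m A'.
  have [->|ne] := eqVneq i i0; last first.
    by exists (delta_mx 0 i); rewrite -rowE row_row_replace (negPf ne).
  (* The relation [u p = v' A] is solved for row [i0], whose coefficient is a nonzero constant. The
     extra [v' 0 i0] compensates for the replaced row in [v' A']. *)
  exists (((v 0 i0)^-1)%:P *: (('X + v' 0 i0) *: delta_mx 0 i0 - v')).
  rewrite -scalemxAl mulmxBl -scalemxAl -rowE row_row_replace eqxx.
  rewrite scalerDl -Dp.
  have -> : v' *m A' = v' *m A - v' 0 i0 *: row i0 A + v' 0 i0 *: p.
    rewrite !mulmx_sum_row (bigD1 i0) //= row_row_replace eqxx.
    rewrite [in RHS](bigD1 i0) //= addrC; congr (_ + _).
    rewrite [_ + \sum_(_ | _) _]addrC addrK.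
    by apply: eq_bigr => j ne; rewrite row_row_replace (negPf ne).
  have cancel_row (x y z : 'rV[{poly F}]_n.+1) : x + y - (x - z + y) = z.
    by apply/rowP => j; rewrite !mxE; ring.
  by rewrite Dp cancel_row scalerA mxE -polyCM mulVf // scale1r.
have IP0 := adjoin_ideal idI IuP IaP.
have [J0 JD JM] := IP0.
have spanA' : row_span A' (adjoin I P).
  move=> w; split=> [[c Ic]|[x ->]].
    have /spanA[y Dy] : I (rVpoly (w - c%:P *: p)).
      by rewrite linearB linearZ /= -mul_polyC.
    have [z Dz] := row_span_rows rowA y; have [b Db] := p_in.
    exists (z + c%:P *: b).
    by rewrite mulmxDl -scalemxAl -Db -Dz -Dy subrK.
  rewrite mulmx_sum_row linear_sum /=; apply: (ideal_sum _ IP0) => i _.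
  rewrite linearZ /= -mul_polyC; apply: (JM); rewrite row_row_replace.
  by case: eqP => _; [apply: adjoin_gen | apply: adjoin_sub].
(* By Cramer's rule, [u] times the new determinant is [v 0 i0] times the old one, so the exponent of
   [u] drops by one. *)
have detA' : \det A' = 'X^m * ((v 0 i0)%:P * r).
  apply: (mulfI X0); rewrite det_row_replace.
  have -> : 'X * (p *m \adj A) 0 i0 = (v' *m A *m \adj A) 0 i0.
    by rewrite Dp -scalemxAl [RHS]mxE.
  rewrite -mulmxA mul_mx_adj mul_mx_scalar mxE detA !mxE exprS; ring.
have [||ts sz_ts dim_ts] := IHm _ phi A' _ _ IP0 _ phi_monic sz_phi spanA' detA'.
- exact: adjoin_sub.
- by rewrite hornerM hornerC mulf_neq0.
exists (a :: ts) => [|t] /=; first by rewrite sz_ts.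
by apply: (loc_dim_adjoin idI nIP IuP IaP).
Qed.

End Chain.

(** * Local dimensions of two plane curves from the Sylvester matrix *)

Section LocalIntersection.

Variable F : closedFieldType.
Local Notation R := {poly {poly F}}.

Definition ideal2 (f g p : R) := exists a b, p = a * f + b * g.

Lemma ideal2_ideal f g : ideal (ideal2 f g).
Proof.
split=> [|p q [a [b ->]] [a' [b' ->]]|p q [a [b ->]]].
- by exists 0, 0; rewrite !mul0r addr0.
- by exists (a + a'), (b + b'); ring.
by exists (p * a), (p * b); ring.
Qed.

(** As [f] has an invertible leading coefficient, [b] in [a f + b g] can be reduced modulo [f] to
    degree below that of [f]. When the sum has degree below [deg f + deg g], the new coefficient of
    [f] then has degree below that of [g]. *)
Lemma sylvester_row_span (f g : R) (c : F) :
  c != 0 -> lead_coef f = c%:P -> g != 0 ->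
  row_span (Sylvester_mx f g) (ideal2 f g).
Proof.
move=> c0 lcf g0 v.
have f0 : f != 0 by rewrite -lead_coef_eq0 lcf polyC_eq0.
have szf : (0 < size f)%N by rewrite size_poly_gt0.
have szg : (0 < size g)%N by rewrite size_poly_gt0.
have sizeM (p q : R) k : (size p <= k)%N -> (0 < size q)%N ->
    (size (p * q)%R <= k + (size q).-1)%N.
  move=> szp szq; apply: leq_trans (size_polyMleq _ _) _.
  by rewrite -subn1 -addnBA // subn1 leq_add2r.
have szaf (a : 'rV_(size g).-1) :
    (size (rVpoly a * f)%R <= (size g).-1 + (size f).-1)%N.
  by apply: sizeM => //; apply: size_poly.
have szbg (b : 'rV_(size f).-1) :
    (size (rVpoly b * g)%R <= (size g).-1 + (size f).-1)%N.
  by rewrite addnC; apply: sizeM => //; apply: size_poly.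
split=> [[a [b Dv]]|[w ->]]; last first.
  rewrite -[w]hsubmxK mul_row_col !mul_rV_lin1 /= linearD /= !poly_rV_K //.
  by exists (rVpoly (lsubmx w)), (rVpoly (rsubmx w)).
pose f1 := (c^-1)%:P%:P * f.
have f1_monic : f1 \is monic.
  by rewrite monicE lead_coefM lead_coefC lcf -polyCM mulVf.
have szf1 : size f1 = size f.
  by rewrite size_Cmul // polyC_eq0 invr_eq0.
have Db := Pdiv.RingMonic.rdivp_eq f1_monic b.
set k := Pdiv.Ring.rdivp b f1 in Db; set r := Pdiv.Ring.rmodp b f1 in Db.
have szr : (size r <= (size f).-1)%N.
  rewrite -ltnS prednK // -szf1; apply: Pdiv.Ring.ltn_rmodpN0.
  exact: monic_neq0.
pose x := a + k * (c^-1)%:P%:P * g.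
have Dv' : rVpoly v = x * f + r * g by rewrite Dv Db /x /f1; ring.
have szx : (size x <= (size g).-1)%N.
  have [-> | x0] := eqVneq x 0; first by rewrite size_poly0.
  have : (size (x * f)%R <= (size g).-1 + (size f).-1)%N.
    rewrite -(addrK (r * g) (x * f)) -Dv'; apply: leq_trans (size_polyD _ _) _.
    rewrite geq_max size_polyN size_poly addnC.
    exact: sizeM.
  by rewrite size_mul // -subn1 -addnBA // subn1 leq_add2r.
exists (row_mx (poly_rV x) (poly_rV r)).
rewrite mul_row_col !mul_rV_lin1 /= !poly_rV_K //.
by apply: (can_inj rVpolyK); rewrite -linearD -Dv' poly_rV_K // size_poly.
Qed.

Lemma local_dims (f g : R) (c : F) m (r : {poly F}) :
    c != 0 -> lead_coef f = c%:P -> g != 0 ->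
    resultant f g = 'X^m * r -> r.[0] != 0 ->
  exists2 ts : seq F, size ts = m &
    forall t, loc_dim (ideal2 f g) t (count_mem t ts).
Proof.
move=> c0 lcf g0 Dres r0.
have f0 : f != 0 by rewrite -lead_coef_eq0 lcf polyC_eq0.
(* A monic multiple of [f] whose degree [deg f + deg g] is the size of the Sylvester matrix. *)
pose phi := (c^-1)%:P%:P * f * 'X^((size g).-1).
apply: (composition_chain (phi := phi) _ _ _ _ _ Dres r0).
- exact: ideal2_ideal.
- by exists ((c^-1)%:P%:P * 'X^((size g).-1)), 0; rewrite /phi; ring.
- rewrite monicE /phi lead_coefM lead_coefXn mulr1 lead_coefM lead_coefC lcf.
  by rewrite -polyCM mulVf.
- have nz : (c^-1)%:P%:P * f != 0 by rewrite mulf_neq0 // !polyC_eq0 invr_eq0.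
  rewrite /phi size_mulXn // size_Cmul ?polyC_eq0 ?invr_eq0 //.
  have : (0 < size f)%N by rewrite size_poly_gt0.
  by case: (size f) => // n _; rewrite addnS.
exact: sylvester_row_span c0 lcf g0.
Qed.

End LocalIntersection.

(** * Homogeneous forms and their charts *)

Section MPolyMorphisms.

Lemma rmorph_mmap n (R : nzRingType) (S S' : comNzRingType) (f : {rmorphism R -> S})
    (phi : {rmorphism S -> S'}) (h : 'I_n -> S) (p : {mpoly R[n]}) :
  phi (mmap f h p) = mmap (phi \o f) (phi \o h) p.
Proof.
rewrite /mmap rmorph_sum; apply: eq_bigr => m _.
rewrite rmorphM /mmap1 rmorph_prod; congr (_ * _).
by apply: eq_bigr => i _; rewrite rmorphXn.
Qed.

Lemma eq_mmap n (R S : nzRingType) (f f' : R -> S) (h h' : 'I_n -> S) (p : {mpoly R[n]}) :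
  f =1 f' -> h =1 h' -> mmap f h p = mmap f' h' p.
Proof.
move=> ef eh; rewrite /mmap; apply: eq_bigr => m _.
by rewrite ef (mmap1_eq _ eh).
Qed.

Lemma mmap_homog n (R : nzRingType) (S : comNzRingType) (f : R -> S)
    (h : 'I_n -> S) (c : S) d (p : {mpoly R[n]}) :
  p \is d.-homog -> mmap f (fun i => c * h i) p = c ^+ d * mmap f h p.
Proof.
move=> /dhomogP hp; rewrite /mmap mulr_sumr; apply: eq_big_seq => m /hp <-.
rewrite mulrCA; congr (_ * _); rewrite /mmap1 /= mdegE -prodrXr -big_split /=.
by apply: eq_bigr => i _; rewrite exprMn.
Qed.

Lemma mmap_id n (R : nzRingType) (p : {mpoly R[n]}) :
  mmap (@mpolyC n R) (fun i => 'X_i) p = p.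
Proof.
rewrite [RHS]mpolyE /mmap; apply: eq_bigr => m _.
by rewrite mmap1_id mul_mpolyC.
Qed.

Lemma poly2_rmorphism (S T : comNzRingType) (f : {rmorphism S -> T}) u v :
  exists phi : {rmorphism {poly {poly S}} -> T},
    [/\ forall c, phi c%:P%:P = f c, phi 'X%:P = u & phi 'X = v].
Proof.
pose g : {rmorphism {poly S} -> T} := horner_eval u \o map_poly f.
exists (horner_eval v \o map_poly g).
split=> [c||]; rewrite [LHS]/= /horner_eval ?(map_polyC g, map_polyX g) ?hornerC ?hornerX //.
  by rewrite [LHS]/= /horner_eval map_polyC hornerC.
by rewrite [LHS]/= /horner_eval map_polyX hornerX.
Qed.

End MPolyMorphisms.

Section Dehomogenization.

Variable F : closedFieldType.
Local Notation R := {poly {poly F}}.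
Variables (a b a' b' : F).
Hypothesis delta0 : a * b' - a' * b != 0.
Local Notation delta := (a * b' - a' * b).

Definition chart (T : Type) (x y z : T) (i : 'I_3) : T :=
  match val i with 0%N => x | 1%N => y | _ => z end.

(* In {poly {poly F}} the inner variable is u and the outer one is T = t_3; the
   fibre over (a:b) is u = 0. *)
Definition chart_var : 'I_3 -> R :=
  chart (a%:P + a' *: 'X)%:P (b%:P + b' *: 'X)%:P 'X.

Definition dehom : {mpoly F[3]} -> R := mmap (polyC \o polyC) chart_var.
HB.instance Definition _ := GRing.RMorphism.on dehom.

Definition ord1_3 : 'I_3 := @Ordinal 3 1 isT.

(* The linear forms dual to (a, b) and (a', b'), so that t_1 / hlambda,
   t_2 / hlambda and hmu / hlambda = u recover the chart. *)
Definition hlambda : {mpoly F[3]} := (b' / delta) *: 'X_ord0 - (a' / delta) *: 'X_ord1_3.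
Definition hmu : {mpoly F[3]} := (a / delta) *: 'X_ord1_3 - (b / delta) *: 'X_ord0.

Lemma dehomZ c P : dehom (c *: P) = c%:P%:P * dehom P.
Proof. exact: mmapZ. Qed.

Lemma dehomD P Q : dehom (P + Q) = dehom P + dehom Q.
Proof. exact: rmorphD. Qed.

Lemma dehomB P Q : dehom (P - Q) = dehom P - dehom Q.
Proof. exact: rmorphB. Qed.

Lemma dehomM P Q : dehom (P * Q) = dehom P * dehom Q.
Proof. exact: rmorphM. Qed.

Lemma rmorph_dehom (S : comNzRingType) (phi : {rmorphism R -> S}) P :
  phi (dehom P) = mmap (phi \o (polyC \o polyC)) (phi \o chart_var) P.
Proof.
pose f : {rmorphism F -> R} := polyC \o polyC.
exact: (rmorph_mmap f phi chart_var P).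
Qed.

Lemma dehomX i : dehom 'X_i = chart_var i.
Proof. by rewrite /dehom mmapX mmap1U. Qed.

Lemma dehom_hlambda : dehom hlambda = 1.
Proof.
rewrite rmorphB /= !dehomZ !dehomX /chart_var /chart /= -!polyCM -polyCB.
rewrite -(polyC1 {poly F}); congr _%:P.
rewrite -!mul_polyC !mulrDr !mulrA -!polyCM opprD addrACA -mulrBl -!polyCB.
have -> : b' / delta * a' - a' / delta * b' = 0 by ring.
by rewrite mul0r addr0 -polyC1; congr _%:P; field.
Qed.

Lemma dehom_hmu : dehom hmu = 'X%:P.
Proof.
rewrite rmorphB /= !dehomZ !dehomX /chart_var /chart /= -!polyCM -polyCB.
congr _%:P.
rewrite -!mul_polyC !mulrDr !mulrA -!polyCM opprD addrACA -mulrBl -!polyCB.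
have -> : a / delta * b' - b / delta * a' = 1 by field.
have -> : a / delta * b - b / delta * a = 0 by ring.
by rewrite polyC0 add0r polyC1 mul1r.
Qed.

Lemma hlambda_hmu0 : a *: hlambda + a' *: hmu = 'X_ord0.
Proof. by apply/mpolyP => m; rewrite /hlambda /hmu !(mcoeffD, mcoeffN, mcoeffZ); field. Qed.

Lemma hlambda_hmu1 : b *: hlambda + b' *: hmu = 'X_ord1_3.
Proof. by apply/mpolyP => m; rewrite /hlambda /hmu !(mcoeffD, mcoeffN, mcoeffZ); field. Qed.

Lemma hlambda_homog : hlambda \is 1.-homog.
Proof.
by apply: rpredB; apply: dhomogZ; rewrite dhomogX /= mdeg1.
Qed.

Lemma hmu_homog : hmu \is 1.-homog.
Proof.
by apply: rpredB; apply: dhomogZ; rewrite dhomogX /= mdeg1.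
Qed.

(** Constants lift to multiples of powers of [hlambda], in every degree; multiplication by [u] or
    [T] lifts to multiplication by [hmu] or [t_3]. The freedom above [n0] allows several lifts to be
    adjusted to prescribed degrees. *)
Lemma homogenize (p : R) :
  exists n0, forall n, (n0 <= n)%N -> exists2 P, P \is n.-homog & dehom P = p.
Proof.
pose hgz q := exists n0, forall n, (n0 <= n)%N ->
  exists2 P, P \is n.-homog & dehom P = q.
have hC c : hgz c%:P%:P.
  exists 0 => n _; exists (c *: hlambda ^+ n).
    by apply: dhomogZ; have := dhomogMn n hlambda_homog; rewrite mul1n.
  by rewrite dehomZ rmorphXn /= dehom_hlambda expr1n mulr1.
have hD q r : hgz q -> hgz r -> hgz (q + r).
  case=> n0 Hq [n1 Hr]; exists (maxn n0 n1) => n; rewrite geq_max => /andP[le0 le1].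
  have [P hP <-] := Hq _ le0; have [Q hQ <-] := Hr _ le1.
  by exists (P + Q); [apply: rpredD | rewrite rmorphD].
have hM q G : G \is 1.-homog -> hgz q -> hgz (q * dehom G).
  move=> hG [n0 Hq]; exists n0.+1 => -[//|n]; rewrite ltnS => /Hq[P hP <-].
  by exists (P * G); [rewrite -(addn1 n); apply: dhomogM | rewrite rmorphM].
rewrite -/(hgz p); elim/poly_ind: p => [|p c IHp]; first exact: hC 0.
apply: (hD).
  rewrite -[X in _ * X](_ : dehom 'X_ord_max = 'X); last by rewrite dehomX.
  by apply: hM => //; rewrite dhomogX /= mdeg1.
elim/poly_ind: c => [|c e IHc]; first exact: hC 0.
by rewrite polyCD polyCM -dehom_hmu; apply: (hD) => //; apply: hM hmu_homog _.
Qed.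

(* Sending u to hmu / hlambda and T to t_3 / hlambda in the fraction field maps
   dehom P to P / hlambda ^+ n. *)
Lemma dehom_inj n (P : {mpoly F[3]}) : P \is n.-homog -> dehom P = 0 -> P = 0.
Proof.
move=> hP dP0.
pose Q := {fraction {mpoly F[3]}}.
have [tf tf_eq0] : exists tf : {rmorphism {mpoly F[3]} -> Q},
    forall G, (tf G == 0) = (G == 0).
  by exists (@tofrac {mpoly F[3]}) => G; apply: tofrac_eq0.
have [j Dj] : exists j : {rmorphism F -> Q}, forall c, j c = tf c%:MP.
  by exists (tf \o @mpolyC 3 F).
have la0 : tf hlambda != 0.
  rewrite tf_eq0; apply: contra_eq_neq dehom_hlambda => ->.
  by rewrite rmorph0 eq_sym oner_eq0.
have [rho [rhoC rhoU rhoX]] :=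
  poly2_rmorphism j (tf hmu / tf hlambda) (tf 'X_ord_max / tf hlambda).
have jZ c G : tf (c *: G) = j c * tf G by rewrite Dj -mul_mpolyC rmorphM.
have jlin x y : rho (x%:P + y *: 'X)%:P
    = (tf hlambda)^-1 * tf (x *: hlambda + y *: hmu).
  rewrite -mul_polyC polyCD polyCM (rmorphD rho) (rmorphM rho) !rhoC rhoU.
  rewrite (rmorphD tf (x *: hlambda)).
  rewrite (jZ x hlambda) (jZ y hmu) mulrDr (mulrCA _ (j x)) mulVf // mulr1.
  by rewrite [_^-1 * (_ * _)]mulrC mulrA.
have : rho (dehom P) = 0 by rewrite dP0 rmorph0.
rewrite rmorph_dehom (@eq_mmap _ _ _ _ j _ (fun i => (tf hlambda)^-1 * tf 'X_i)).
- rewrite (mmap_homog _ _ _ hP).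
  have -> : mmap j (fun i => tf 'X_i) P = tf P.
    rewrite -[in RHS](mmap_id P) rmorph_mmap.
    by apply: eq_mmap.
  move/eqP; rewrite mulf_eq0 expf_eq0 invr_eq0 (negPf la0) andbF tf_eq0.
  by move/eqP.
- by move=> c; apply: rhoC.
case=> -[|[|[|//]]] lti /=; rewrite /chart_var /chart /=.
- by rewrite jlin hlambda_hmu0; congr (_ * tf 'X_ _); apply: val_inj.
- by rewrite jlin hlambda_hmu1; congr (_ * tf 'X_ _); apply: val_inj.
rewrite rhoX mulrC; congr (_ * tf 'X_ _); exact: val_inj.
Qed.

End Dehomogenization.

(** * Intersection multiplicities computed in a chart *)

Section Imult.

Variable F : closedFieldType.
Local Notation R := {poly {poly F}}.
Variables (a b a' b' : F).
Hypothesis delta0 : a * b' - a' * b != 0.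
Local Notation dehom := (dehom a b a' b').

Lemma ev0_dehom t P : ev0 t (dehom P) = P.@[chart a b t].
Proof.
rewrite rmorph_dehom /meval; apply: eq_mmap => [c|i] /=.
  by rewrite ev0C hornerC.
rewrite /chart_var /chart; case: (val i) => [|[|n]]; last by rewrite ev0X.
  by rewrite ev0C !hornerE.
by rewrite ev0C !hornerE.
Qed.

Lemma meval_homogZ n (P : {mpoly F[3]}) (A B : 'I_3 -> F) c :
  P \is n.-homog -> (forall i, A i = c * B i) -> P.@[A] = c ^+ n * P.@[B].
Proof.
by move=> hP DA; rewrite (meval_eq _ DA); apply: mmap_homog hP.
Qed.

(** The coefficients of the local relation are homogenized, in degrees large enough for all three
    lifts and such that both sides are forms of degree [m + n]. Injectivity of [dehom] on forms of
    one degree then gives the relation between forms. *)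
Lemma ideal2_homog n e e' (f g H : {mpoly F[3]}) t :
    f \is e.-homog -> g \is e'.-homog -> H \is n.-homog ->
    loc (ideal2 (dehom f) (dehom g)) t (dehom H) ->
  exists m W x y, [/\ W \is m.-homog, ev0 t (dehom W) != 0 & W * H = x * f + y * g].
Proof.
move=> hf hg hH [w w0 [x [y Dwh]]].
have [nw Hw] := homogenize delta0 w.
have [nx Hx] := homogenize delta0 x.
have [ny Hy] := homogenize delta0 y.
pose m := (nw + (nx + e) + (ny + e'))%N.
have [|W hW DW] := Hw m; first by rewrite /m -addnA leq_addr.
have [|X hX DX] := Hx (m + n - e)%N.
  by rewrite leq_subRL /m; lia.
have [|Y hY DY] := Hy (m + n - e')%N; first by rewrite /m; lia.
exists m, W, X, Y; split=> //; first by rewrite DW.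
apply/eqP; rewrite -subr_eq0; apply/eqP.
apply: (@dehom_inj _ _ _ _ _ delta0 (m + n)).
  apply: rpredB; first exact: dhomogM.
  apply: rpredD.
    have -> : (m + n = (m + n - e) + e)%N by rewrite /m; lia.
    exact: dhomogM.
  have -> : (m + n = (m + n - e') + e')%N by rewrite /m; lia.
  exact: dhomogM.
by rewrite dehomB dehomD !dehomM DW DX DY Dwh subrr.
Qed.

Lemma fracs_homog k (N D : 'I_k -> {mpoly F[3]}) :
    (forall i, exists e, N i \is e.-homog /\ D i \is e.-homog) ->
  exists n, forall i, N i * \prod_(j < k | j != i) D j \is n.-homog.
Proof.
move=> /fin_all_exists[e he]; exists (\sum_i e i)%N => i.
have hND j : N j \is (e j).-homog by case: (he j).
have hD j : D j \is (e j).-homog by case: (he j).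
have -> : (\sum_i e i = e i + \sum_(j < k | j != i) e j)%N by rewrite (bigD1 i).
apply: dhomogM => //.
elim/big_rec2: _ => [|j x y _ hxy]; first exact: dhomog1.
exact: dhomogM.
Qed.

Lemma dehom_lcomb k (c : 'I_k -> F) (N : 'I_k -> {mpoly F[3]}) :
  dehom (\sum_i c i *: N i) = lcomb c (fun i => dehom (N i)).
Proof. by rewrite /lcomb rmorph_sum; apply: eq_bigr => i _; apply: dehomZ. Qed.

(** The fractions are brought to a common denominator; by [ideal2_homog] their numerators stay free
    after dehomogenization. *)
Lemma has_indep_family_leq e e' (f g : {mpoly F[3]}) A c t k k' :
    f \is e.-homog -> g \is e'.-homog -> c != 0 -> (forall i, A i = c * chart a b t i) ->
    loc_dim (ideal2 (dehom f) (dehom g)) t k ->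
  has_indep_family f g A k' -> (k' <= k)%N.
Proof.
move=> hf hg c0 DA dimk [N [D [hND [D0 indepND]]]].
have [n hn] := fracs_homog hND.
apply: (loc_free_leq (e := fun i => dehom (N i * \prod_(j < k' | j != i) D j))
  (ideal2_ideal _ _) dimk) => x.
rewrite -dehom_lcomb => locx.
have hH : \sum_i x i *: (N i * \prod_(j < k' | j != i) D j) \is n.-homog.
  by apply: rpred_sum => i _; apply: rpredZ.
have [m [W [y [z [hW W0 DW]]]]] := ideal2_homog hf hg hH locx.
apply: indepND; exists W, y, z; split; first by exists m.
by split=> //; rewrite (meval_homogZ hW DA) -ev0_dehom mulf_neq0 ?expf_neq0.
Qed.

(** A local basis is homogenized in one degree [m] and divided by [hlambda ^+ m], which
    dehomogenizes to 1 and so does not vanish at [A]. *)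
Lemma has_indep_family_dim e e' (f g : {mpoly F[3]}) A c t k :
    f \is e.-homog -> g \is e'.-homog -> c != 0 ->
    (forall i, A i = c * chart a b t i) ->
    loc_dim (ideal2 (dehom f) (dehom g)) t k ->
  has_indep_family f g A k.
Proof.
move=> hf hg c0 DA [u [freeu _]].
have evA n P : P \is n.-homog -> (P.@[A] != 0) = (ev0 t (dehom P) != 0).
  move=> hP; rewrite (meval_homogZ hP DA) -ev0_dehom mulf_eq0 expf_eq0.
  by rewrite (negPf c0) andbF.
have [n Hn] := fin_all_exists (fun i => homogenize delta0 (u i)).
pose m := (\sum_i n i)%N.
have /fin_all_exists2[N hN DN] : forall i, exists2 P, P \is m.-homog & dehom P = u i.
  by move=> i; apply: Hn; rewrite /m (bigD1 i) //= leq_addr.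
pose L := hlambda a b a' b'.
have hL : L ^+ m \is m.-homog.
  by have := dhomogMn m (hlambda_homog a b a' b'); rewrite mul1n.
have dL : dehom (L ^+ m) = 1 by rewrite rmorphXn /= dehom_hlambda // expr1n.
exists N, (fun=> L ^+ m); split; first by move=> i; exists m.
split=> [_|x [W [y [z [[d hW] [W0 DW]]]]]].
  by rewrite (evA _ _ hL) dL rmorph1 oner_eq0.
apply: freeu; exists (dehom W); first by rewrite -(evA _ _ hW).
exists (dehom y), (dehom z); rewrite -!dehomM -dehomD -DW dehomM dehom_lcomb.
congr (_ * _); apply: eq_bigr => i _; rewrite dehomM DN rmorph_prod.
by rewrite big1 ?mulr1 // => j _; rewrite dL.
Qed.

(** The value [k] is attained and maximal, so the choice in [imult] is not a default value and must
    be [k]. *)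
Lemma imult_local e e' (f g : {mpoly F[3]}) A c t k :
    f \is e.-homog -> g \is e'.-homog -> c != 0 ->
    (forall i, A i = c * chart a b t i) ->
    loc_dim (ideal2 (dehom f) (dehom g)) t k ->
  imult f g A = k.
Proof.
move=> hf hg c0 DA dimk; rewrite /imult.
set Q := fun _ => _.
have /(epsilon_spec (inhabits 0%N))[] : exists k, Q k.
  exists k; split=> [|k']; first exact: has_indep_family_dim hf hg c0 DA dimk.
  exact: has_indep_family_leq hf hg c0 DA dimk.
set k' := epsilon _ _ => fam max; apply/eqP; rewrite eqn_leq.
rewrite (has_indep_family_leq hf hg c0 DA dimk fam) /=.
by apply: max; apply: has_indep_family_dim hf hg c0 DA dimk.
Qed.

End Imult.

(** * Generic combinations *)

(** When both leading coefficients survive, the degrees and hence the shape of the Sylvester matrix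
    are preserved. *)
Lemma map_resultant_neq0 (R S : comNzRingType) (f : {rmorphism R -> S}) p q :
    f (lead_coef p) != 0 -> f (lead_coef q) != 0 ->
  f (resultant p q) = resultant (map_poly f p) (map_poly f q).
Proof.
move=> p0 q0; rewrite /resultant -det_map_mx /Sylvester_mx map_col_mx.
rewrite -(size_map_poly_id0 p0) -(size_map_poly_id0 q0).
by congr (\det (col_mx _ _)); apply: map_lin1_mx => v;
  rewrite /= map_poly_rV rmorphM /= map_rVpoly.
Qed.

Lemma map_lead_coef_neq0 (R S : nzRingType) (f : {rmorphism R -> S}) (p : {poly R}) n :
  (size p <= n.+1)%N -> f p`_n != 0 -> f (lead_coef p) != 0.
Proof.
move=> szp fpn; rewrite lead_coefE.
suff -> : size p = n.+1 by [].
apply/eqP; rewrite eqn_leq szp ltnNge; apply/negP => sz.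
by rewrite nth_default ?rmorph0 ?eqxx in fpn.
Qed.

Section GenericCombinations.

Variable K : closedFieldType.
Implicit Types (sigma : 'I_3 -> {poly K}).

Definition shift3 (j : bool) (i : 'I_3) : 'I_6 :=
  if j then rshift 3 i else lshift 3 i.

Definition generic_comb sigma j : {poly {mpoly K[6]}} :=
  \sum_(i < 3) ('X_(shift3 j i))%:P * map_poly (@mpolyC 6 K) (sigma i).

Lemma size_generic_comb sigma j n :
  (forall i, (size (sigma i) <= n)%N) -> (size (generic_comb sigma j) <= n)%N.
Proof.
move=> sz; apply: leq_trans (size_sum _ _ _) _; apply/bigmax_leqP => i _.
rewrite mul_polyC; apply: leq_trans (size_scale_leq _ _) _.
exact: leq_trans (size_poly _ _) (sz i).
Qed.

Lemma map_generic_comb (S : comNzRingType) (phi : {rmorphism {mpoly K[6]} -> S})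
    sigma j :
  map_poly phi (generic_comb sigma j)
    = \sum_(i < 3) (phi 'X_(shift3 j i))%:P * map_poly (phi \o @mpolyC 6 K) (sigma i).
Proof.
rewrite rmorph_sum; apply: eq_bigr => i _.
by rewrite rmorphM /= map_polyC map_poly_comp.
Qed.

Lemma generic_comb_neq0 sigma j n :
  (forall i, size (sigma i) = n.+1) -> generic_comb sigma j != 0.
Proof.
move=> sz; pose v k : K := (k == shift3 j ord0)%:R.
pose phi : {rmorphism {mpoly K[6]} -> K} := meval v.
have : sigma ord0 != 0 by rewrite -size_poly_eq0 sz.
apply: contra_neq => g0.
have -> : sigma ord0 = map_poly phi (generic_comb sigma j).
  rewrite map_generic_comb (bigD1 ord0) //= big1 ?addr0 => [|i i0].
    rewrite mevalXU /v eqxx mul1r; apply: esym; apply: map_poly_id => x _ /=.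
    exact: mevalC.
  rewrite mevalXU /v; rewrite (_ : (_ == _) = false) ?mul0r //; apply: contraNF i0.
  by case: j {phi v g0} => /eqP/(congr1 val) /= e; apply/eqP/val_inj => /=; lia.
by rewrite g0 rmorph0.
Qed.

Lemma forall_ord3 (P : 'I_3 -> Prop) :
  P ord0 -> P (@Ordinal 3 1 isT) -> P (@Ordinal 3 2 isT) -> forall i, P i.
Proof.
by move=> P0 P1 P2 [[|[|[|//]]] lti];
  [have -> : Ordinal lti = ord0 | have -> : Ordinal lti = @Ordinal 3 1 isT
  | have -> : Ordinal lti = @Ordinal 3 2 isT] => //; apply: val_inj.
Qed.

Lemma sum_ord3 (V : nmodType) (f : 'I_3 -> V) :
  \sum_i f i = f ord0 + f (@Ordinal 3 1 isT) + f (@Ordinal 3 2 isT).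
Proof.
rewrite !big_ord_recl big_ord0 addr0 addrA.
by congr (f _ + f _ + f _); apply: val_inj.
Qed.

(** It suffices to find one specialization with nonzero resultant: [sigma_0] against
    [sigma_1 + c sigma_2], for [c] outside a finite set. *)
Lemma generic_resultant_neq0 sigma n :
    (forall i, size (sigma i) = n.+1) ->
    (forall r, exists i, (sigma i).[r] != 0) ->
  resultant (generic_comb sigma false) (generic_comb sigma true) != 0.
Proof.
move=> sz noroot.
have lead0 i : (sigma i)`_n != 0.
  by have := lead_coef_eq0 (sigma i); rewrite lead_coefE -size_poly_eq0 sz => ->.
pose i1 : 'I_3 := @Ordinal 3 1 isT; pose i2 : 'I_3 := @Ordinal 3 2 isT.
have [rs Drs] := closed_field_poly_normal (sigma ord0).
(* The roots of [G] are the values of [c] to avoid: those where the degree of [sigma_1 + c sigma_2]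
   drops, and those where it shares a root with [sigma_0]. *)
pose G : {poly K} := (((sigma i1)`_n)%:P + (sigma i2)`_n *: 'X) *
  \prod_(r <- rs | root (sigma ord0) r) ((sigma i1).[r]%:P + (sigma i2).[r] *: 'X).
have lin_neq0 (x y : K) : (x != 0) || (y != 0) -> x%:P + y *: 'X != 0.
  apply: contraTneq => e0; have := congr1 (fun p : {poly K} => p`_0) e0.
  have := congr1 (fun p : {poly K} => p`_1) e0.
  by rewrite !coefD !coefZ !coefC !coefX /= !mulr0 mulr1 add0r addr0 => -> ->; rewrite eqxx.
have : G != 0.
  rewrite mulf_neq0 //; first by apply: lin_neq0; rewrite lead0.
  rewrite prodf_seq_neq0; apply/allP => r _; apply/implyP => rr.
  apply: lin_neq0; have [i] := noroot r.
  by elim/forall_ord3: i => [|->|->]; rewrite ?orbT // -rootE rr.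
case/closed_nonrootP => c; rewrite /root hornerM mulf_eq0 negb_or => /andP[lead_c roots_c].
(* The specialization [x = (1, 0, 0)], [y = (0, 1, c)]. *)
pose v (j : 'I_6) := match val j with 0%N | 4%N => 1 | 5%N => c | _ => 0 end.
pose phi : {rmorphism {mpoly K[6]} -> K} := meval v.
have phiX j : phi 'X_j = v j by apply: mevalXU.
have phiC (p : {poly K}) : map_poly (phi \o @mpolyC 6 K) p = p.
  by apply: map_poly_id => x _ /=; rewrite mevalC.
pose q := sigma i1 + c *: sigma i2.
have Dp : map_poly phi (generic_comb sigma false) = sigma ord0.
  rewrite map_generic_comb sum_ord3 !phiX !phiC /v /=.
  by rewrite !mul0r !addr0 mul1r.
have Dq : map_poly phi (generic_comb sigma true) = q.
  rewrite map_generic_comb sum_ord3 !phiX !phiC /v /=.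
  by rewrite mul0r add0r mul1r mul_polyC.
have szg j : (size (generic_comb sigma j) <= n.+1)%N.
  by apply: size_generic_comb => i; rewrite sz.
have qn : q`_n != 0.
  rewrite coefD coefZ mulrC.
  by move: lead_c; rewrite hornerD hornerC hornerZ hornerX.
apply: contraTneq isT => res0.
have : resultant (sigma ord0) q = 0.
  rewrite -Dp -Dq -map_resultant_neq0 ?res0 ?rmorph0 //.
    by apply: (map_lead_coef_neq0 (szg false)); rewrite -coef_map Dp.
  by apply: (map_lead_coef_neq0 (szg true)); rewrite -coef_map Dq.
move/eqP; rewrite resultant_eq0 => szgcd.
have /closed_rootP[r] : size (gcdp (sigma ord0) q) != 1%N.
  by apply: contraTneq szgcd => ->.
rewrite root_gcd => /andP[r0 rq]; case/negP: roots_c.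
rewrite horner_prod prodf_seq_eq0; apply/hasP; exists r.
  move: r0; rewrite Drs rootZ ?root_prod_XsubC //.
  by rewrite lead_coefE sz.
by rewrite r0 /= !hornerE; move: rq; rewrite /q /root !hornerE mulrC.
Qed.

Variables (F : closedFieldType) (iota : {rmorphism K -> F}) (z : 'I_6 -> F).
Hypothesis z_indep : alg_indep iota z.

Definition eval_comb sigma j (tau : F) : F :=
  \sum_(i < 3) z (shift3 j i) * (map_poly iota (sigma i)).[tau].

Lemma horner_generic_comb sigma j tau :
  (map_poly (mmap iota z) (generic_comb sigma j)).[tau] = eval_comb sigma j tau.
Proof.
rewrite map_generic_comb horner_sum; apply: eq_bigr => i _.
rewrite hornerM hornerC /= mmapX mmap1U; congr (_ * _.[_]).
by apply: eq_map_poly => x /=; rewrite mmapC.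
Qed.

Lemma mmap_alg_indep_neq0 p : p != 0 -> mmap iota z p != 0.
Proof. by apply: contra_neq => /z_indep. Qed.

(** The generic resultant is a nonzero polynomial, so its value at the algebraically independent [z]
    is nonzero, whereas the common root [tau] would make it vanish. *)
Lemma eval_comb_no_common_root n sigma tau :
    (forall i, size (sigma i) = n.+1) ->
    ~ (exists r, forall i, (sigma i).[r] = 0) ->
    (forall j, eval_comb sigma j tau = 0) -> False.
Proof.
move=> sz noroot tau0.
have res0 : resultant (generic_comb sigma false) (generic_comb sigma true) != 0.
  apply: generic_resultant_neq0 sz _ => r; apply: NNPP => nr; apply: noroot.
  by exists r => i; apply/eqP/negP => /negP nz; apply: nr; exists i.
have lead0 j : lead_coef (generic_comb sigma j) != 0.
  by rewrite lead_coef_eq0; apply: generic_comb_neq0 sz.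
have := mmap_alg_indep_neq0 res0.
rewrite map_resultant_neq0 ?mmap_alg_indep_neq0 // resultant_eq0 -leqNgt leqNgt.
move/negP; apply.
have gcd0 : gcdp (map_poly (mmap iota z) (generic_comb sigma false))
                 (map_poly (mmap iota z) (generic_comb sigma true)) != 0.
  rewrite gcdp_eq0 negb_and; apply/orP; left.
  by rewrite -lead_coef_eq0 lead_coef_map_eq mmap_alg_indep_neq0.
apply: (root_size_gt1 (a := tau)) => //.
have rootj j : root (map_poly (mmap iota z) (generic_comb sigma j)) tau.
  by apply/eqP; apply: etrans (horner_generic_comb sigma j tau) (tau0 j).
rewrite root_gcd.
by apply/andP; split; apply: rootj.
Qed.

(* While the sigma_i have a common root r in K, either tau = iota r or X - r can
   be divided out. *)
Lemma common_root_rational n sigma tau :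
    (forall i, size (sigma i) = n.+1) ->
    (forall j, eval_comb sigma j tau = 0) ->
  exists2 r, tau = iota r & forall i, (sigma i).[r] = 0.
Proof.
elim: n sigma => [|n IHn] sigma sz tau0;
  have [[r r0]|noroot] := classic (exists r, forall i, (sigma i).[r] = 0);
  try by case: (eval_comb_no_common_root sz noroot tau0).
  have := r0 ord0; have [c c0 ->] := size_poly1P _ (introT eqP (sz ord0)).
  by rewrite hornerC => /eqP; rewrite (negPf c0).
have [|neq_tau] := eqVneq tau (iota r); first by exists r.
have /fin_all_exists[q Dq] : forall i, exists q, sigma i = q * ('X - r%:P).
  by move=> i; apply/factor_theorem; rewrite /root r0.
have [||x Dx x0] := IHn q.
- move=> i; have := sz i; rewrite Dq size_Mmonic ?monicXsubC //.
    by rewrite size_XsubC addn2 => -[].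
  by apply: contra_eq_neq (sz i) => q0; rewrite Dq q0 mul0r size_poly0.
- move=> j; have := tau0 j; rewrite /eval_comb.
  have e i : (map_poly iota (sigma i)).[tau] = (map_poly iota (q i)).[tau] * (tau - iota r).
    by rewrite Dq rmorphM hornerM rmorphB /= map_polyX map_polyC !hornerE.
  under eq_bigr do rewrite e mulrA.
  by rewrite -mulr_suml => /eqP; rewrite mulf_eq0 subr_eq0 (negPf neq_tau) orbF => /eqP.
by exists x => // i; rewrite Dq hornerM x0 mul0r.
Qed.

End GenericCombinations.

(** * Homogeneity *)

(** Induction on [d]: if [d] is positive, the product vanishes at 0, so one factor is divisible by
    the variable. *)
Lemma factor_monomial (D : idomainType) (p q : {poly D}) c d :
  c != 0 -> p * q = c *: 'X^d -> exists a e, p = a *: 'X^e.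
Proof.
move=> c0; elim: d p q => [|d IHd] p q Dpq.
  have : size (p * q) == 1%N by rewrite Dpq size_scale // size_polyXn.
  rewrite size_mul_eq1 => /andP[/size_poly1P[a a0 ->] _].
  by exists a, 0; rewrite expr0 alg_polyC.
have [/factor_theorem[r Dr]|p0] := boolP (root p 0).
  have [|a [e Da]] := IHd r q.
    apply: (mulIf (negbT (polyX_eq0 D))); rewrite -scalerAl -exprSr -Dpq Dr.
    by rewrite polyC0 subr0 mulrAC.
  by exists a, e.+1; rewrite Dr Da polyC0 subr0 -scalerAl exprSr.
have [/factor_theorem[r Dr]|q0] := boolP (root q 0).
  apply: (IHd p r); apply: (mulIf (negbT (polyX_eq0 D))).
  by rewrite -scalerAl -exprSr -Dpq Dr polyC0 subr0 mulrA.
have /eqP := congr1 (horner_eval 0) Dpq.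
rewrite /horner_eval hornerM hornerZ hornerXn expr0n mulr0 mulf_eq0.
by rewrite -!rootE (negPf p0) (negPf q0).
Qed.

Section Homogeneity.

Variables (n : nat) (R : idomainType).
Implicit Types (p q : {mpoly R[n]}).

(** Replacing each [t_i] by [X t_i] turns homogeneous components into coefficients of powers of [X],
    so homogeneous polynomials are those whose image is a monomial in [X]. *)
Definition dilate : {mpoly R[n]} -> {poly {mpoly R[n]}} :=
  mmap (polyC \o @mpolyC n R) (fun i => 'X * ('X_i)%:P).
HB.instance Definition _ := GRing.RMorphism.on dilate.

Lemma dilateE p :
  dilate p = \sum_(m <- msupp p) (p@_m *: 'X_[m])%:P * 'X^(mdeg m).
Proof.
apply: eq_bigr => m _ /=; rewrite -mul_mpolyC polyCM -mulrA; congr (_ * _).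
rewrite -[in 'X_[m]]mmap1_id /mmap1 mdegE rmorph_prod /= -prodrXr -big_split /=.
by apply: eq_bigr => i _; rewrite exprMn mulrC rmorphXn.
Qed.

Lemma coef_dilate p e : (dilate p)`_e = pihomog mdeg e p.
Proof.
rewrite dilateE pihomogE coef_sum [RHS]big_mkcond; apply: eq_bigr => m _ /=.
by rewrite coefCM coefXn eq_sym; case: eqP; rewrite ?mulr1 ?mulr0.
Qed.

Lemma dilate_homog p d : p \is d.-homog -> dilate p = p *: 'X^d.
Proof.
move=> hp; apply/polyP => e; rewrite coef_dilate coefZ coefXn.
case: eqP => [->|ne]; first by rewrite mulr1 pihomog_dE.
by rewrite mulr0 (pihomog_ne0 (d := d)) // eq_sym; apply/eqP.
Qed.

(** The dilation of [p] divides a monomial in [X], hence is itself a monomial; setting [X = 1] shows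
    that its coefficient is [p]. *)
Lemma homog_factor p q d :
  p * q != 0 -> p * q \is d.-homog -> exists e, p \is e.-homog.
Proof.
move=> pq0 /dilate_homog; rewrite rmorphM => /(factor_monomial pq0)[a [e De]].
have Da : a = p.
  have /(congr1 (horner_eval 1)) : dilate p = a *: 'X^e := De.
  rewrite (dilateE p) /horner_eval horner_sum hornerZ hornerXn expr1n mulr1 => <-.
  rewrite [RHS]mpolyE; apply: eq_bigr => m _.
  by rewrite hornerM hornerC hornerXn expr1n mulr1.
exists e; rewrite homog_piE -coef_dilate De coefZ coefXn eqxx mulr1.
by rewrite Da.
Qed.

End Homogeneity.

(** * Homogeneity of the resultant of two graded polynomials *)

Section CoefficientHomogeneity.

Variables (n k : nat) (K : idomainType).
Local Notation T := {mpoly {mpoly K[n]}[k]}.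
Implicit Types (x y : T) (p q : {poly T}).

Definition coef_homog e x := forall m, x@_m \is e.-homog.

Lemma coef_homog0 e : coef_homog e 0.
Proof. by move=> m; rewrite mcoeff0 rpred0. Qed.

Lemma coef_homogD e x y : coef_homog e x -> coef_homog e y -> coef_homog e (x + y).
Proof. by move=> hx hy m; rewrite mcoeffD rpredD. Qed.

Lemma coef_homogN e x : coef_homog e x -> coef_homog e (- x).
Proof. by move=> hx m; rewrite mcoeffN rpredN. Qed.

Lemma coef_homogM e f x y :
  coef_homog e x -> coef_homog f y -> coef_homog (e + f) (x * y).
Proof.
move=> hx hy m; rewrite mcoeffM; apply: rpred_sum => i _.
exact: dhomogM.
Qed.

Lemma coef_homogC c : c \is 0.-homog -> coef_homog 0 c%:MP.
Proof.
by move=> hc m; rewrite mcoeffC; case: eqP; rewrite ?mulr1 // mulr0 rpred0.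
Qed.

Lemma coef_homogX i : coef_homog 0 'X_i.
Proof. by move=> m; rewrite mcoeffX; case: eqP; rewrite ?rpred0 ?dhomog1. Qed.

Lemma coef_homog1 : coef_homog 0 1.
Proof. by rewrite -mpolyC1; apply: coef_homogC; apply: dhomog1. Qed.

(** Total degree [d] when the main variable and the innermost indeterminates have weight 1, and the
    indeterminates of the middle ring have weight 0. The zero case is separate because the
    subtraction [d - i] is truncated. *)
Definition graded d p :=
  forall i, (p`_i = 0) \/ (i <= d)%N /\ coef_homog (d - i) p`_i.

Lemma graded0 d : graded d 0.
Proof. by move=> i; left; rewrite coef0. Qed.

Lemma gradedD d p q : graded d p -> graded d q -> graded d (p + q).
Proof.
move=> hp hq i; rewrite coefD; case: (hp i) => [->|[le hpi]].
  by rewrite add0r; apply: hq.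
case: (hq i) => [->|[_ hqi]]; first by rewrite addr0; right.
by right; split=> //; apply: coef_homogD.
Qed.

Lemma graded_sum d (J : Type) (r : seq J) (P : pred J) (f : J -> {poly T}) :
  (forall j, P j -> graded d (f j)) -> graded d (\sum_(j <- r | P j) f j).
Proof.
move=> hf; elim/big_ind: _ => //; [exact: graded0 | exact: gradedD].
Qed.

Lemma gradedM d e p q : graded d p -> graded e q -> graded (d + e) (p * q).
Proof.
move=> hp hq i; rewrite coefM; elim/big_ind: _ => [|x y|[j /= ltj] _].
- by left.
- move=> [->|[le hx]]; first by rewrite add0r.
  case=> [->|[_ hy]]; first by rewrite addr0; right.
  by right; split=> //; apply: coef_homogD.
case: (hp j) => [->|[lej hpj]]; first by left; rewrite mul0r.
case: (hq (i - j)%N) => [->|[lei hqi]]; first by left; rewrite mulr0.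
right; split; first lia.
have -> : (d + e - i = d - j + (e - (i - j)))%N by lia.
exact: coef_homogM.
Qed.

Lemma gradedC d x : coef_homog d x -> graded d x%:P.
Proof.
move=> hx [|i]; rewrite coefC /=; last by left.
by right; rewrite subn0.
Qed.

Lemma gradedX : graded 1 'X.
Proof.
move=> i; rewrite coefX; case: eqP => [->|]; last by left.
by right; split=> //; apply: coef_homog1.
Qed.

Lemma graded_exp d p e : graded d p -> graded (d * e) (p ^+ e).
Proof.
move=> hp; elim: e => [|e IHe]; rewrite ?muln0.
  by rewrite expr0; apply: gradedC; apply: coef_homog1.
by rewrite exprS mulnS; apply: gradedM.
Qed.

(** A nonzero term of the Leibniz expansion has degree the sum of all [al] minus the sum of all
    [be], whatever the permutation. *)
Lemma det_coef_homog m (A : 'M[T]_m) (al be : 'I_m -> nat) :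
    (forall i j, A i j = 0 \/ (be j <= al i)%N /\ coef_homog (al i - be j) (A i j)) ->
  coef_homog (\sum_i al i - \sum_j be j) (\det A).
Proof.
move=> hA; rewrite /determinant; set d := (_ - _)%N.
elim/big_ind: _ => [|x y hx hy|s _]; [exact: coef_homog0 | exact: coef_homogD |].
have [[i Ai0]|nz] : (exists i, A i (s i) = 0) \/ (forall i, A i (s i) <> 0).
  have [/existsP[i /eqP]|/existsPn nz] := boolP [exists i, A i (s i) == 0].
    by left; exists i.
  by right => i; apply/eqP.
  by rewrite (bigD1 i) //= Ai0 mul0r mulr0; apply: coef_homog0.
have le i : (be (s i) <= al i)%N by case: (hA i (s i)) => [/nz|[]].
have hAi i : coef_homog (al i - be (s i)) (A i (s i)).
  by case: (hA i (s i)) => [/nz|[]].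
have -> : d = (\sum_i (al i - be (s i)))%N.
  by rewrite sumnB // /d [X in (_ - X)%N](reindex_inj (@perm_inj _ s)).
rewrite -[(\sum_i _)%N]add0n; apply: coef_homogM.
  case: (odd_perm s); rewrite ?expr0 ?expr1; last exact: coef_homog1.
  exact/coef_homogN/coef_homog1.
elim/big_rec2: _ => [|i x y _ hx]; first exact: coef_homog1.
exact: coef_homogM.
Qed.

Lemma resultant_coef_homog d p q :
    size p = d.+1 -> size q = d.+1 -> graded d p -> graded d q ->
  exists e, coef_homog e (resultant p q).
Proof.
move=> szp szq hp hq.
(* Row [l] of either Sylvester block has in column [j] the coefficient of index [j - l], of degree
   [(d + l) - j]; so rows get weight [d + l] and columns weight [j]. *)
pose al (i : 'I_((size q).-1 + (size p).-1)) :=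
  (d + match split i with inl k => (k : nat) | inr k => (k : nat) end)%N.
exists (\sum_i al i - \sum_(j < (size q).-1 + (size p).-1) j)%N.
apply: det_coef_homog => i j; rewrite Sylvester_mxE /al.
have aux r (l : nat) : graded d r -> (r`_(j - l) *+ (l <= j) = 0) \/
    (j <= d + l)%N /\ coef_homog (d + l - j) (r`_(j - l) *+ (l <= j)).
  move=> hr; case: (leqP l j) => [lekj|]; last by left.
  rewrite mulr1n; case: (hr (j - l)%N) => [|[le hrk]]; first by left.
  right; split; first lia.
  by have -> : (d + l - j = d - (j - l))%N by lia.
by case: (split i) => l; apply: aux.
Qed.

End CoefficientHomogeneity.

(** * Divisibility of a binary form by the linear form of one of its zeros *)

Section LinearForm.

Variables (K : closedFieldType) (a b a' b' : K).
Hypothesis delta0 : a * b' - a' * b != 0.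
Local Notation delta := (a * b' - a' * b).

Definition pair2 (S : Type) (x y : S) (i : 'I_2) : S :=
  match val i with 0%N => x | _ => y end.

(** [plambda] and [pmu] are the basis of linear forms dual to [(a, b)] and [(a', b')]; in particular
    [pmu] vanishes at [(a, b)]. *)
Definition pmu : {mpoly K[2]} :=
  (a / delta) *: 'X_ord_max - (b / delta) *: 'X_ord0.
Definition plambda : {mpoly K[2]} :=
  (b' / delta) *: 'X_ord0 - (a' / delta) *: 'X_ord_max.

(* P is the value at T = pmu of a polynomial in T with constant term
   plambda ^+ n * P(a, b) = 0. *)
Lemma pmu_dvd n (P : {mpoly K[2]}) :
  P \is n.-homog -> P.@[pair2 a b] = 0 -> mdvd pmu P.
Proof.
move=> hP P0.
pose h i : {poly {mpoly K[2]}} :=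
  (pair2 a b i *: plambda)%:P + (pair2 a' b' i)%:MP%:P * 'X.
pose f : {rmorphism K -> {poly {mpoly K[2]}}} := polyC \o @mpolyC 2 K.
pose H := mmap f h P.
have Dh i : pair2 a b i *: plambda + pair2 a' b' i *: pmu = 'X_i.
  case: i => -[|[|//]] lti; apply/mpolyP => m;
    rewrite /plambda /pmu /pair2 /= !(mcoeffD, mcoeffN, mcoeffZ).
    by rewrite (_ : Ordinal lti = ord0); [field | apply: val_inj].
  by rewrite (_ : Ordinal lti = ord_max); [field | apply: val_inj].
have evH u : H.[u] = mmap (@mpolyC 2 K) (fun i => pair2 a b i *: plambda + pair2 a' b' i *: u) P.
  pose e : {rmorphism {poly {mpoly K[2]}} -> {mpoly K[2]}} := horner_eval u.
  rewrite -[LHS]/(e (mmap f h P)) (rmorph_mmap f e).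
  apply: eq_mmap => [c|i]; rewrite /= /horner_eval ?hornerC //.
  by rewrite /h hornerD hornerM !hornerC hornerX mul_mpolyC.
have H0 : root H 0.
  rewrite /root evH.
  rewrite (@eq_mmap _ _ _ _ (@mpolyC 2 K) _ (fun i => plambda * (pair2 a b i)%:MP)) //.
    rewrite (mmap_homog _ _ _ hP).
    have -> : mmap (@mpolyC 2 K) (fun i => (pair2 a b i)%:MP) P = (P.@[pair2 a b])%:MP.
      pose e : {rmorphism K -> {mpoly K[2]}} := @mpolyC 2 K.
      by rewrite /meval -[RHS]/(e _) (rmorph_mmap idfun e).
    by rewrite P0 mpolyC0 mulr0.
  by move=> i; rewrite scaler0 addr0 mulrC mul_mpolyC.
have /factor_theorem[q Dq] := H0.
exists q.[pmu]; rewrite mulrC.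
have -> : P = H.[pmu] by rewrite evH -[LHS]mmap_id; apply: eq_mmap.
by rewrite Dq polyC0 subr0 hornerM hornerX.
Qed.

Lemma meval_pmu : pmu.@[pair2 a b] = 0.
Proof.
by rewrite /pmu mevalB !mevalZ !mevalXU /pair2 /=; ring.
Qed.

End LinearForm.

(** * The content of the resultant and its primitive cofactor *)

Section Content.

Variables (K : closedFieldType) (R : {mpoly {mpoly K[2]}[6]}) (C : {mpoly K[2]}) (e : nat).
Hypotheses (contC : is_content R C) (R0 : R != 0) (hR : coef_homog e R).

Lemma content_factor : exists R', R = C%:MP * R'.
Proof.
rewrite [R]mpolyE; elim/big_ind: _ => [|x y [x' ->] [y' ->]|m _].
- by exists 0; rewrite mulr0.
- by exists (x' + y'); rewrite mulrDr.
have [r ->] := contC.1 m.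
by exists (r *: 'X_[m]); rewrite mul_mpolyC scalerA.
Qed.

Lemma content_neq0 : C != 0.
Proof.
have [R' DR] := content_factor.
by apply: contra_neq R0 => C0; rewrite DR C0 mpolyC0 mul0r.
Qed.

Lemma content_homog : exists c, C \is c.-homog.
Proof.
have [R' DR] := content_factor.
have [m Rm] : exists m, R@_m != 0.
  by exists (mlead R); rewrite mleadc_eq0.
have := hR m; move: Rm; rewrite DR mcoeffCM => Rm.
exact: homog_factor.
Qed.

Lemma content_cofactor_homog R' m : R = C%:MP * R' -> exists c, R'@_m \is c.-homog.
Proof.
move=> DR; have [->|Rm] := eqVneq R'@_m 0; first by exists 0; rewrite rpred0.
have := hR m; rewrite DR mcoeffCM mulrC; apply: homog_factor.
by rewrite mulf_neq0 // content_neq0.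
Qed.

(** Otherwise [pmu] divides every coefficient of [R'], so [C * pmu] divides every coefficient of [R]
    and hence [C]. Then [pmu] would be a unit, although it vanishes at [(a, b)]. *)
Lemma content_primitive R' (a b a' b' : K) :
  R = C%:MP * R' -> a * b' - a' * b != 0 -> exists m, (R'@_m).@[pair2 a b] != 0.
Proof.
move=> DR delta0; apply: NNPP => no_m.
have R'0 m : (R'@_m).@[pair2 a b] = 0.
  by apply/eqP/negP => /negP nz; apply: no_m; exists m.
have [|r Dr] := contC.2 (C * pmu a b a' b').
  move=> m; have [c hc] := content_cofactor_homog m DR.
  have [q Dq] := pmu_dvd delta0 hc (R'0 m).
  by exists q; rewrite DR mcoeffCM Dq mulrA.
have /eqP := Dr; rewrite -mulrA -{1}[C]mulr1 (inj_eq (mulfI content_neq0)).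
move=> /eqP/(congr1 (meval (pair2 a b))).
by rewrite meval1 mevalM meval_pmu mul0r => /eqP; rewrite oner_eq0.
Qed.

End Content.

(** * Specializing the resultant *)

Section ChangeOfIndeterminates.

Variable K : closedFieldType.

(** The transpose of [N] acts on the [x] and on the [y] separately. For the matrix of [L] these are
    the coefficients of the [s_i] in [V_1^L] and [V_2^L]. *)
Definition lin (S : nzRingType) (f : K -> S) (N : 'M[K]_3) (x : 'I_6 -> S) (i : 'I_6) : S :=
  match split (i : 'I_(3 + 3)) with
  | inl i' => \sum_(k < 3) f (N k i') * x (shift3 false k)
  | inr i' => \sum_(k < 3) f (N k i') * x (shift3 true k)
  end.

Lemma linE (S : nzRingType) (f : K -> S) N x j i :
  lin f N x (shift3 j i) = \sum_(k < 3) f (N k i) * x (shift3 j k).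
Proof.
by rewrite /lin; case: j; rewrite /shift3;
  [rewrite -[rshift 3 i]/(unsplit (inr i)) | rewrite -[lshift 3 i]/(unsplit (inl i))];
  rewrite unsplitK.
Qed.

Lemma shift3P (i : 'I_6) : exists j k, i = shift3 j k.
Proof.
rewrite -[i](@splitK 3 3); case: (split _) => k; first by exists false, k.
by exists true, k.
Qed.

Lemma lin_lin (S : comNzRingType) (f : {rmorphism K -> S}) N M x :
  lin f N (lin f M x) =1 lin f (M *m N) x.
Proof.
move=> i; have [j [k ->]] := shift3P i; rewrite !linE.
under eq_bigr do rewrite linE mulr_sumr.
rewrite exchange_big; apply: eq_bigr => l _ /=.
rewrite mxE rmorph_sum mulr_suml; apply: eq_bigr => m _.
by rewrite rmorphM mulrA (mulrC (f (N _ _))).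
Qed.

Lemma lin1 (S : comNzRingType) (f : {rmorphism K -> S}) x : lin f 1%:M x =1 x.
Proof.
move=> i; have [j [k ->]] := shift3P i; rewrite linE (bigD1 k) //= big1.
  by rewrite mxE eqxx rmorph1 mul1r addr0.
by move=> l /negPf nlk; rewrite mxE nlk rmorph0 mul0r.
Qed.

Lemma eq_lin (S : nzRingType) (f g : K -> S) N x y :
  f =1 g -> x =1 y -> lin f N x =1 lin g N y.
Proof.
move=> efg exy i; have [j [k ->]] := shift3P i; rewrite !linE.
by apply: eq_bigr => l _; rewrite efg exy.
Qed.

Lemma rmorph_lin (S T : nzRingType) (f : K -> S) (phi : {rmorphism S -> T}) N x i :
  phi (lin f N x i) = lin (phi \o f) N (phi \o x) i.
Proof.
have [j [k ->]] := shift3P i; rewrite !linE rmorph_sum.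
by apply: eq_bigr => l _; rewrite rmorphM.
Qed.

(** A relation [p] among the transformed elements yields a relation [q] among the original ones.
    Then [q] is 0, and substituting with the inverse matrix recovers [p = 0]. *)
Lemma alg_indep_lin (F : closedFieldType) (iota : {rmorphism K -> F}) z N :
  N \in unitmx -> alg_indep iota z -> alg_indep iota (lin iota N z).
Proof.
move=> uN z_indep p p0.
pose c : {rmorphism K -> {mpoly K[6]}} := @mpolyC 6 K.
pose X (i : 'I_6) : {mpoly K[6]} := 'X_i.
pose q := mmap c (lin c N X) p.
have q0 : q = 0.
  apply: z_indep; rewrite -[RHS]p0 /q.
  pose ev : {rmorphism {mpoly K[6]} -> F} := mmap iota z.
  rewrite -[LHS]/(ev _) (rmorph_mmap c ev); apply: eq_mmap => [x|i].
    by rewrite /= mmapC.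
  rewrite -[LHS]/(ev (lin c N X i)) rmorph_lin; apply: eq_lin => [x|k].
    by rewrite /= mmapC.
  by rewrite /= mmapX mmap1U.
pose phi : {rmorphism {mpoly K[6]} -> {mpoly K[6]}} := mmap c (lin c (invmx N) X).
have : phi q = 0 by rewrite q0 rmorph0.
rewrite /q (rmorph_mmap c phi) => <-.
rewrite -[LHS]mmap_id; apply: eq_mmap => [x|i]; first by rewrite /= mmapC.
rewrite -[RHS]/(phi (lin c N X i)) rmorph_lin.
rewrite (@eq_lin _ _ c _ _ (lin c (invmx N) X)); first last.
- by move=> k; rewrite /= mmapX mmap1U.
- by move=> x; rewrite /= mmapC.
by rewrite lin_lin mulVmx // lin1.
Qed.

Lemma alg_indep_comb_neq0 (F : closedFieldType) (iota : {rmorphism K -> F}) z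
    (c : 'I_3 -> K) j k :
  alg_indep iota z -> c k != 0 ->
  \sum_(i < 3) z (shift3 j i) * iota (c i) != 0.
Proof.
move=> z_indep ck; pose p : {mpoly K[6]} := \sum_(i < 3) c i *: 'X_(shift3 j i).
have -> : \sum_(i < 3) z (shift3 j i) * iota (c i) = mmap iota z p.
  rewrite /p (raddf_sum (mmap iota z)); apply: eq_bigr => i _.
  by rewrite /= mmapZ mmapX mmap1U mulrC.
apply: mmap_alg_indep_neq0 => //; apply: contra_neq ck => p0.
have := congr1 (mcoeff U_(shift3 j k)) p0.
rewrite /p raddf_sum /= mcoeff0 (bigD1 k) //= big1 => [|i nik].
  by rewrite addr0 mcoeffZ mcoeffXU eqxx mulr1.
rewrite mcoeffZ mcoeffXU (_ : (_ == _) = false) ?mulr0 //.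
apply: contraNF nik; case: (j) => /eqP/(congr1 val) /= e;
  apply/eqP/val_inj => /=; lia.
Qed.

End ChangeOfIndeterminates.

(** * Grading and evaluation of [V_1^L] and [V_2^L] *)

Section EvalRT.

Variables (K : closedFieldType) (s : 'I_3 -> {mpoly K[3]}) (d : nat).
Hypothesis hs : forall i, s i \is d.-homog.
Local Notation T := {mpoly {mpoly K[2]}[6]}.

Definition toRT_var (i : 'I_3) : RT K :=
  match val i with
  | 0%N => ((('X_ord0 : {mpoly K[2]})%:MP) : T)%:P
  | 1%N => ((('X_(inord 1) : {mpoly K[2]})%:MP) : T)%:P
  | _ => 'X
  end.

Definition cKm : {rmorphism K -> RT K} :=
  polyC \o (@mpolyC 6 {mpoly K[2]} \o @mpolyC 2 K).

Lemma toRTE (p : {mpoly K[3]}) : toRT p = mmap cKm toRT_var p.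
Proof. by []. Qed.

Lemma graded_toRT_var i : graded 1 (toRT_var i).
Proof.
elim/forall_ord3: i; rewrite /toRT_var /=; last exact: gradedX.
  by apply/gradedC => m; rewrite mcoeffC; case: eqP;
    rewrite ?mulr1 ?mulr0 ?rpred0 // dhomogX /= mdeg1.
by apply/gradedC => m; rewrite mcoeffC; case: eqP;
    rewrite ?mulr1 ?mulr0 ?rpred0 // dhomogX /= mdeg1.
Qed.

Lemma graded_cK (c : K) : graded 0 (cK c).
Proof.
apply/gradedC/coef_homogC; rewrite -[c%:MP]mulr1 mul_mpolyC.
exact/dhomogZ/dhomog1.
Qed.

Lemma graded_toRT (p : {mpoly K[3]}) : p \is d.-homog -> graded d (toRT p).
Proof.
move=> /dhomogP hp; rewrite /toRT /mmap big_seq; apply: graded_sum => m /hp Dm.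
rewrite -[d]add0n; apply: gradedM; first exact: graded_cK.
rewrite -Dm /mmap1 /= mdegE; elim/big_rec2: _ => [|i x y _ hx].
  by rewrite -polyC1; apply/gradedC/coef_homog1.
apply: gradedM => //.
by have := graded_exp (m i) (graded_toRT_var i); rewrite mul1n.
Qed.

Lemma graded_VL M j : graded d (VL s M j).
Proof.
apply: graded_sum => i _; rewrite -[d]add0n; apply: gradedM.
  by apply/gradedC/coef_homogX.
apply: graded_sum => k _; rewrite -[d]add0n; apply: gradedM.
  exact: graded_cK.
exact: graded_toRT.
Qed.

Lemma size_graded (n k : nat) (D : idomainType) (p : {poly {mpoly {mpoly D[n]}[k]}}) e :
  graded e p -> (size p <= e.+1)%N.
Proof.
move=> hp; apply/leq_sizeP => i lti; case: (hp i) => // -[lei _].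
by move: lti; rewrite ltnNge lei.
Qed.

Section Eval.

Variables (S : comNzRingType) (kappa : {rmorphism K -> S}) (w : 'I_2 -> S) (zeta : 'I_6 -> S).

Definition evalC : {rmorphism {mpoly K[2]} -> S} := mmap kappa w.
Definition evalRT : {rmorphism T -> S} := mmap evalC zeta.

(* The restriction of p to the line of points (w_0 : w_1 : X). *)
Definition restrict (p : {mpoly K[3]}) : {poly S} :=
  mmap (polyC \o kappa) (chart (w ord0)%:P (w ord_max)%:P 'X) p.

Lemma map_toRT (p : {mpoly K[3]}) : map_poly evalRT (toRT p) = restrict p.
Proof.
pose ev : {rmorphism RT K -> {poly S}} := map_poly evalRT.
rewrite toRTE -[LHS]/(ev _) (rmorph_mmap cKm ev).
apply: eq_mmap => [c|i].
  by rewrite /= map_polyC /= /evalRT /= mmapC /evalC /= mmapC.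
have inord1 : inord 1 = ord_max :> 'I_2 by apply: val_inj; rewrite /= inordK.
elim/forall_ord3: i; rewrite /= /toRT_var /chart /=.
- by rewrite map_polyC /= mmapC /= mmapX mmap1U.
- by rewrite map_polyC /= mmapC /= mmapX mmap1U inord1.
by rewrite map_polyX.
Qed.

Lemma map_VL M j :
  map_poly evalRT (VL s M j) =
    \sum_(k < 3) (lin kappa M zeta (shift3 j k))%:P * restrict (s k).
Proof.
rewrite /VL rmorph_sum /=.
transitivity (\sum_(i < 3) \sum_(k < 3)
    (kappa (M i k) * zeta (shift3 j i))%:P * restrict (s k)).
  apply: eq_bigr => i _; rewrite rmorphM /= map_polyC /= mmapX mmap1U.
  rewrite rmorph_sum mulr_sumr; apply: eq_bigr => k _.
  rewrite rmorphM /= map_toRT mulrA; congr (_ * _).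
  by rewrite /cK map_polyC /= mmapC /= mmapC -polyCM mulrC.
rewrite exchange_big; apply: eq_bigr => k _ /=.
by rewrite -mulr_suml linE rmorph_sum.

Qed.

(** In degree [d], only the monomial [t_3 ^ d] contributes to [X ^ d], and it is also the only one
    that survives at [(0, 0, 1)]. *)
Lemma restrict_top p : p \is d.-homog -> (restrict p)`_d = kappa p.@[e3].
Proof.
move=> /dhomogP hp; rewrite /restrict /meval /mmap coef_sum rmorph_sum.
rewrite !big_seq; apply: eq_bigr => m /hp /=.
rewrite mdegE /mmap1 !big_ord_recl !big_ord0 /chart /e3 /= addn0 mulr1 !expr1n !mulr1.
set m0 := m _; set m1 := m _; set m2 := m _ => Dd.
rewrite -!rmorphXn /= mulrA mulrA -!polyCM coefCM coefXn.
have [D2|n2] := eqVneq d m2.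
  have -> : m0 = 0%N by lia.
  have -> : m1 = 0%N by lia.
  by rewrite !expr0 !mulr1.
rewrite mulr0; have [m00|m00] := posnP m0.
  have m1_gt0 : (0 < m1)%N by lia.
  by rewrite m00 expr0 !expr0n [m1 == _]eqn0Ngt m1_gt0 !mulr0 rmorph0.
by rewrite expr0n eqn0Ngt m00 !(mul0r, mulr0) rmorph0.
Qed.

End Eval.

Lemma size_restrict (S : comNzRingType) (kappa : {rmorphism K -> S}) w p :
  p \is d.-homog -> (size (restrict kappa w p) <= d.+1)%N.
Proof.
move=> hp; rewrite -(map_toRT kappa w (fun=> 0)).
by apply: leq_trans (size_poly _ _) (size_graded (graded_toRT hp)).
Qed.

End EvalRT.

(** * Multiplicities along a fibre *)

Lemma sum_count_uniq (T : eqType) (S ts : seq T) :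
  uniq S -> {subset ts <= S} -> (\sum_(x <- S) count_mem x ts = size ts)%N.
Proof.
move=> uS; elim: ts => [|t ts IHts] sub; first by rewrite big1.
rewrite big_split /= IHts => [|x x_ts]; last by apply: sub; rewrite inE x_ts orbT.
rewrite (bigD1_seq t) //= ?eqxx ?sub ?mem_head // big1 // => x /negPf.
by rewrite eq_sym => ->.
Qed.

Lemma sum_count_mem (J : finType) (T : eqType) (P : pred J) (g : J -> T) (ts : seq T) :
    (forall i j, P i -> P j -> g i = g j -> i = j) ->
    (forall t, t \in ts -> exists2 j, P j & t = g j) ->
  (\sum_(j | P j) count_mem (g j) ts = size ts)%N.
Proof.
move=> g_inj g_surj; rewrite -(sum_count_uniq (S := [seq g j | j <- enum P])).
- by rewrite big_map big_enum.
- rewrite map_inj_in_uniq ?enum_uniq // => i j; rewrite !mem_enum; exact: g_inj.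
by move=> t /g_surj[j Pj ->]; rewrite map_f // mem_enum.
Qed.

Section Fiber.

Variables (K : closedFieldType) (s : 'I_3 -> {mpoly K[3]}) (d : nat).
Hypotheses (hs : forall i, s i \is d.-homog) (he3 : forall i, (s i).@[e3] != 0).
Variables (F : closedFieldType) (iota : {rmorphism K -> F}) (z : 'I_6 -> F).
Hypothesis z_indep : alg_indep iota z.
Variables (M : 'M[K]_3).
Hypothesis uM : M \in unitmx.

Local Notation V := (Vcurve iota z s).
Local Notation RL := (resultant (VL s M false) (VL s M true)).

(** Evaluating [VL s M] at [z'] cancels [M] and gives the curves [V] at [z]. *)
Let z' := lin iota (invmx M) z.

Lemma transformed_indep : alg_indep iota z'.
Proof. by apply: alg_indep_lin => //; rewrite unitmx_inv. Qed.

Lemma Vcurve_homog j : V j \is d.-homog.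
Proof.
apply: rpred_sum => i _; rewrite mul_mpolyC; apply: dhomogZ.
have /dhomogP hp := hs i; apply/dhomogP => m.
by rewrite (perm_mem (msupp_map_mpoly _ (fmorph_inj iota))) => /hp.
Qed.

Section Chart.

Variables (a b a' b' : K).
Hypothesis delta0 : a * b' - a' * b != 0.

Local Notation dehomF := (dehom (iota a) (iota b) (iota a') (iota b')).

Let kappa : {rmorphism K -> {poly F}} := polyC \o iota.
Let wF := pair2 ((iota a)%:P + iota a' *: 'X) ((iota b)%:P + iota b' *: 'X).

(** The substitution of [(a + a' u, b + b' u)] for [(t_1, t_2)] and of [z'] for the indeterminates;
    the order at [u = 0] of the image of the resultant is what the fibre over [(a:b)]
    contributes. *)
Definition fiber_eval : {rmorphism {mpoly {mpoly K[2]}[6]} -> {poly F}} :=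
  evalRT kappa wF (polyC \o z').

Lemma deltaF0 : iota a * iota b' - iota a' * iota b != 0.
Proof. by rewrite -!rmorphM -rmorphB fmorph_eq0. Qed.

Lemma dehom_map_mpoly p : dehomF (map_mpoly iota p) = restrict kappa wF p.
Proof.
pose c : {rmorphism K -> {mpoly F[3]}} := @mpolyC 3 F \o iota.
pose phi : {rmorphism {mpoly F[3]} -> {poly {poly F}}} := dehomF.
rewrite -[LHS]/(phi (mmap c (fun i => 'X_i) p)) (rmorph_mmap c phi).
apply: eq_mmap => [x|i].
  by rewrite -[LHS]/(dehomF (iota x)%:MP) /dehom mmapC.
by rewrite -[LHS]/(dehomF 'X_i) dehomX.
Qed.

Lemma map_VL_dehom j : map_poly fiber_eval (VL s M j) = dehomF (V j).
Proof.
rewrite map_VL.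
pose phi : {rmorphism {mpoly F[3]} -> {poly {poly F}}} := dehomF.
rewrite -[RHS]/(phi (\sum_(i < 3) _)) rmorph_sum.
apply: eq_bigr => k _; rewrite -[RHS]/(dehomF (_ * _)) dehomM dehom_map_mpoly.
congr (_ * _).
rewrite /dehom mmapC /=; congr _%:P.
pose cF : {rmorphism F -> {poly F}} := polyC.
rewrite -[LHS]/(lin (cF \o iota) M (cF \o z') (shift3 j k)) -rmorph_lin.
by rewrite /z' lin_lin mulVmx // lin1.
Qed.

(** The value of [V j] at [(0, 0, 1)], which is its coefficient of [T ^ d] in every chart. It does
    not involve [u]. *)
Let lcV j := \sum_(k < 3) z (shift3 j k) * iota (s k).@[e3].

Lemma lcV_neq0 j : lcV j != 0.
Proof. exact: (alg_indep_comb_neq0 j z_indep (he3 ord0)). Qed.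

Lemma coef_fiber j : (dehomF (V j))`_d = (lcV j)%:P.
Proof.
rewrite -map_VL_dehom map_VL coef_sum /lcV rmorph_sum; apply: eq_bigr => k _.
rewrite coefCM (restrict_top _ _ (hs k)) rmorphM; congr (_ * _).
pose cF : {rmorphism F -> {poly F}} := polyC.
rewrite -[LHS]/(lin (cF \o iota) M (cF \o z') (shift3 j k)) -rmorph_lin.
by rewrite /z' lin_lin mulVmx // lin1.
Qed.

Lemma size_VL_leq j : (size (VL s M j) <= d.+1)%N.
Proof. exact: size_graded (graded_VL hs M j). Qed.

Lemma size_fiber_leq j : (size (dehomF (V j)) <= d.+1)%N.
Proof. by rewrite -map_VL_dehom; apply: leq_trans (size_poly _ _) (size_VL_leq j). Qed.

Lemma lead_coef_fiber j : lead_coef (dehomF (V j)) = (lcV j)%:P.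
Proof.
rewrite -coef_fiber lead_coefE; congr (_`_ _).
have : (d < size (dehomF (V j)))%N.
  rewrite ltnNge; apply/negP => /leq_sizeP/(_ d (leqnn d))/eqP.
  by rewrite coef_fiber polyC_eq0 (negPf (lcV_neq0 j)).
have := size_fiber_leq j; case: (size _) => // n; rewrite !ltnS => le1 le2.
by apply/eqP; rewrite eqn_leq le1.
Qed.

Lemma fiber_eval_lead j : fiber_eval (lead_coef (VL s M j)) != 0.
Proof.
apply: (map_lead_coef_neq0 (size_VL_leq j)).
by rewrite -coef_map map_VL_dehom coef_fiber polyC_eq0 lcV_neq0.
Qed.

Lemma size_VL j : size (VL s M j) = d.+1.
Proof.
apply/eqP; rewrite eqn_leq size_VL_leq ltnNge; apply/negP => /leq_sizeP/(_ d (leqnn d)) e.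
have fe0 : fiber_eval (VL s M j)`_d = 0 by rewrite e; exact: rmorph0.
have := coef_fiber j; rewrite -map_VL_dehom => /(etrans (esym (coef_map fiber_eval _ _))).
move=> /(etrans (esym fe0))/eqP.
by rewrite eq_sym polyC_eq0 (negPf (lcV_neq0 j)).
Qed.

Lemma fiber_eval_resultant : fiber_eval RL = resultant (dehomF (V false)) (dehomF (V true)).
Proof.
rewrite -(map_VL_dehom false) -(map_VL_dehom true).
exact: (map_resultant_neq0 (fiber_eval_lead false) (fiber_eval_lead true)).
Qed.

Definition slice (k : 'I_3) : {poly K} := restrict idfun (pair2 a b) (s k).

Lemma size_slice k : size (slice k) = d.+1.
Proof.
apply/eqP; rewrite eqn_leq (size_restrict _ _ (hs k)) ltnNge; apply/negP.
move=> /leq_sizeP/(_ d (leqnn d)); rewrite (restrict_top _ _ (hs k)) => /eqP.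
by rewrite /= (negPf (he3 k)).
Qed.

Lemma horner_slice k r : (slice k).[r] = (s k).@[chart a b r].
Proof.
pose f : {rmorphism K -> {poly K}} := polyC \o idfun.
pose ev : {rmorphism {poly K} -> K} := horner_eval r.
rewrite -[LHS]/(ev _) /slice /restrict (rmorph_mmap f ev); apply: eq_mmap => [c|i].
  by rewrite /= /horner_eval hornerC.
by elim/forall_ord3: i; rewrite /= /horner_eval /chart /= ?hornerC ?hornerX.
Qed.

Lemma ev0_fiber j tau : ev0 tau (dehomF (V j)) = eval_comb iota z slice j tau.
Proof.
rewrite ev0_dehom /V.
pose ev : {rmorphism {mpoly F[3]} -> F} := meval (chart (iota a) (iota b) tau).
rewrite -[LHS]/(ev _) /Vcurve rmorph_sum; apply: eq_bigr => k _.
rewrite rmorphM; congr (_ * _); first exact: mevalC.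
pose c : {rmorphism K -> {mpoly F[3]}} := @mpolyC 3 F \o iota.
rewrite -[LHS]/(ev (mmap c (fun i => 'X_i) (s k))) (rmorph_mmap c ev).
pose f : {rmorphism K -> {poly K}} := polyC \o idfun.
pose ev2 : {rmorphism {poly K} -> F} := horner_eval tau \o map_poly iota.
rewrite -[RHS]/(ev2 (slice k)) /slice /restrict (rmorph_mmap f ev2).
apply: eq_mmap => [x|i].
  by rewrite /= /horner_eval map_polyC hornerC mevalC.
elim/forall_ord3: i; rewrite /= mevalXU /horner_eval /chart /=.
- by rewrite map_polyC hornerC.
- by rewrite map_polyC hornerC.
by rewrite map_polyX hornerX.
Qed.

Lemma nonzero_chart r : nonzero3 (chart a b r).
Proof.
have [a0|a0] := eqVneq a 0; last by exists ord0.
exists (@Ordinal 3 1 isT); rewrite /chart /=.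
by apply: contra_neq delta0 => ->; rewrite a0 mul0r mulr0 subr0.
Qed.

Lemma fiber_common_zero tau :
    (forall j, ev0 tau (dehomF (V j)) = 0) ->
  exists2 r, tau = iota r & is_base_point s (chart a b r).
Proof.
move=> tau0; have [|r Dr r0] := @common_root_rational K F iota z z_indep d slice tau size_slice.
  by move=> j; rewrite -ev0_fiber.
exists r => //; split; first exact: nonzero_chart.
by move=> k; rewrite -horner_slice.
Qed.

(** At [u = 0] a vanishing resultant gives a common root [tau] over [F], which by
    [fiber_common_zero] comes from a base point on the fibre. *)
Lemma fiber_eval_neq0 :
  (forall r, ~ is_base_point s (chart a b r)) -> (fiber_eval RL).[0] != 0.
Proof.
move=> nobase; apply/negP => /eqP.
pose ev : {rmorphism {poly F} -> F} := horner_eval 0.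
have lead0 j : ev (lead_coef (dehomF (V j))) != 0.
  by rewrite lead_coef_fiber /= /horner_eval hornerC lcV_neq0.
rewrite fiber_eval_resultant -[LHS]/(ev _) map_resultant_neq0 // => /eqP.
rewrite resultant_eq0 => szgcd.
have /closed_rootP[tau] : size (gcdp (map_poly ev (dehomF (V false)))
    (map_poly ev (dehomF (V true)))) != 1%N.
  by apply: contraTneq szgcd => ->.
rewrite root_gcd => /andP[tau0 tau1].
have evj j : ev0 tau (dehomF (V j)) = (map_poly ev (dehomF (V j))).[tau].
  have -> : tau = ev tau%:P by rewrite /= /horner_eval hornerC.
  by rewrite horner_map /= /horner_eval hornerC.
have [|r _] := fiber_common_zero (tau := tau); last exact: nobase.
by case; rewrite evj; apply/eqP.
Qed.

Definition fiber_poly (C : {mpoly K[2]}) : {poly K} :=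
  mmap polyC (pair2 (a%:P + a' *: 'X) (b%:P + b' *: 'X)) C.

Lemma fiber_evalC C : fiber_eval C%:MP = map_poly iota (fiber_poly C).
Proof.
rewrite -[LHS]/(evalRT kappa wF (polyC \o z') C%:MP) /evalRT /= mmapC.
pose c : {rmorphism K -> {poly K}} := polyC.
pose m : {rmorphism {poly K} -> {poly F}} := map_poly iota.
rewrite /evalC /= -[RHS]/(m _) /fiber_poly (rmorph_mmap c m).
apply: eq_mmap => [x|[[|[|//]] lti]]; rewrite /= /wF /pair2 /=.
- by rewrite map_polyC.
- by rewrite rmorphD /= map_polyC map_polyZ map_polyX.
by rewrite rmorphD /= map_polyC map_polyZ map_polyX.
Qed.

Lemma fiber_eval0 R' :
  (fiber_eval R').[0] = mmap iota z' (map_mpoly (meval (pair2 a b)) R').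
Proof.
pose f : {rmorphism {mpoly K[2]} -> {mpoly K[6]}} := @mpolyC 6 K \o meval (pair2 a b).
pose h : {rmorphism {poly F} -> F} := horner_eval 0.
pose k : {rmorphism {mpoly K[6]} -> F} := mmap iota z'.
rewrite -[LHS]/(h (mmap (evalC kappa wF) (polyC \o z') R')).
rewrite -[RHS]/(k (mmap f (fun i => 'X_i) R')) (rmorph_mmap (evalC kappa wF) h).
rewrite (rmorph_mmap f k); apply: eq_mmap => [c|i]; last first.
  by rewrite /= mmapX mmap1U /horner_eval hornerC.
rewrite -[RHS]/(k (c.@[pair2 a b])%:MP) /k /= mmapC.
rewrite -[LHS]/(h (mmap kappa wF c)) (rmorph_mmap kappa h).
pose id1 : {rmorphism K -> K} := idfun.
rewrite -[RHS]/(iota (mmap id1 (pair2 a b) c)) (rmorph_mmap id1 iota).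
apply: eq_mmap => [x|[[|[|//]] lti]].
- by rewrite /= /horner_eval hornerC.
- by rewrite /= /horner_eval /wF /pair2 /= !hornerE.
by rewrite /= /horner_eval /wF /pair2 /= !hornerE.
Qed.

(** The cofactor [R'] does not vanish at [u = 0]: one of its coefficients is nonzero at [(a, b)],
    and [z'] is algebraically independent. The power of [u] thus comes from the content alone. *)
Lemma fiber_eval_factor C R' k q :
    RL = C%:MP * R' -> (exists m, (R'@_m).@[pair2 a b] != 0) ->
    fiber_poly C = 'X^k * q -> q.[0] != 0 ->
  exists2 q', fiber_eval RL = 'X^k * q' & q'.[0] != 0.
Proof.
move=> DR [m Rm] Dq q0; exists (map_poly iota q * fiber_eval R').
  rewrite DR (rmorphM fiber_eval C%:MP) fiber_evalC Dq rmorphM /= map_polyXn.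
  by rewrite mulrA.
rewrite hornerM mulf_neq0 //.
  by rewrite -[X in _.[X]](rmorph0 iota) horner_map fmorph_eq0.
rewrite fiber_eval0 mmap_alg_indep_neq0 //; first exact: transformed_indep.
by apply: contra_neq Rm => e; rewrite -mcoeff_map_mpoly e mcoeff0.
Qed.

Definition on_fiber (A : 'I_3 -> K) := A ord0 * b == A (@Ordinal 3 1 isT) * a.
(** For [A] over [(a:b)], Cramer's rule gives this as the scalar [c] with
    [(A_0, A_1) = c (a, b)]. *)
Definition fiber_scale (A : 'I_3 -> K) :=
  (b' * A ord0 - a' * A (@Ordinal 3 1 isT)) / (a * b' - a' * b).
Definition fiber_coord (A : 'I_3 -> K) := A (@Ordinal 3 2 isT) / fiber_scale A.

Lemma base_point_neq_e3 A : is_base_point s A ->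
  (A ord0 != 0) || (A (@Ordinal 3 1 isT) != 0).
Proof.
case=> nzA sA; apply: contraT; rewrite negb_or !negbK => /andP[/eqP A0 /eqP A1].
have DA i : A i = A (@Ordinal 3 2 isT) * e3 i.
  by elim/forall_ord3: i; rewrite /e3 /= ?mulr0 ?mulr1.
have := sA ord0; rewrite (meval_homogZ (hs ord0) DA) => /eqP.
rewrite mulf_eq0 expf_eq0 (negPf (he3 ord0)) orbF => /andP[_ /eqP A2].
by case: nzA => i; rewrite DA A2 mul0r eqxx.
Qed.

Lemma on_fiber_base A : is_base_point s A -> on_fiber A ->
  [/\ fiber_scale A != 0,
      forall i, A i = fiber_scale A * chart a b (fiber_coord A) i
    & is_base_point s (chart a b (fiber_coord A))].
Proof.
move=> baseA /eqP onA.
have E0 : A ord0 = fiber_scale A * a.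
  rewrite /fiber_scale mulrAC mulrBl -[a' * _ * a]mulrA -onA.
  rewrite [a' * _]mulrCA mulrC -[b' * _ * a]mulrA [b' * _]mulrCA -mulrBr.
  by rewrite [b' * a]mulrC mulrCA mulVf ?mulr1.
have E1 : A (@Ordinal 3 1 isT) = fiber_scale A * b.
  rewrite /fiber_scale mulrAC mulrBl -[b' * _ * b]mulrA onA.
  rewrite [b' * _]mulrCA -[a' * _ * b]mulrA [a' * _]mulrCA -mulrBr.
  by rewrite [b' * a]mulrC -mulrA mulfV ?mulr1.
have sc0 : fiber_scale A != 0.
  by apply: contraTneq (base_point_neq_e3 baseA) => sc; rewrite E0 E1 sc !mul0r eqxx.
have DA i : A i = fiber_scale A * chart a b (fiber_coord A) i.
  elim/forall_ord3: i; rewrite /chart /= // /fiber_coord mulrC divfK //.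
split=> //; split=> [|k]; first exact: nonzero_chart.
have /eqP := baseA.2 k; rewrite (meval_homogZ (hs k) DA) mulf_eq0 expf_eq0.
by rewrite (negPf sc0) andbF => /eqP.
Qed.

Lemma chart_on_fiber A c r : (forall i, chart a b r i = c * A i) -> on_fiber A.
Proof.
move=> DA; have c0 : c != 0.
  have [i] := nonzero_chart r; rewrite DA; apply: contra_neq => ->; exact: mul0r.
apply/eqP/(mulfI c0); have := DA ord0; have := DA (@Ordinal 3 1 isT).
by rewrite /chart /= !mulrA => <- <-; rewrite mulrC.
Qed.

(** The multiplicity of a base point on the fibre is the number of occurrences of its coordinate in
    the list [ts] of [local_dims]. Every member of [ts] is the coordinate of exactly one listed base
    point, so the sum is the length [k] of [ts]. *)
Lemma fiber_sum (l : seq ('I_3 -> K)) k q :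
    base_points_reps s l -> fiber_eval RL = 'X^k * q -> q.[0] != 0 ->
  (\sum_(i < size l | on_fiber (nth (fun=> 0%R) l i))
     imult (V false) (V true) (fun j => iota (nth (fun=> 0%R) l i j)))%N = k.
Proof.
move=> [base_l [nprop_l all_l]] Dk q0.
have [|ts <- dim_ts] := local_dims (lcV_neq0 false) (lead_coef_fiber false) _
  (etrans (esym fiber_eval_resultant) Dk) q0.
  by rewrite -lead_coef_eq0 lead_coef_fiber polyC_eq0 lcV_neq0.
have idI := ideal2_ideal (dehomF (V false)) (dehomF (V true)).
pose A (i : 'I_(size l)) := nth (fun=> 0%R) l i.
have baseA i : is_base_point s (A i) by apply: base_l.
have imultE i : on_fiber (A i) ->
    imult (V false) (V true) (fun j => iota (A i j)) = count_mem (iota (fiber_coord (A i))) ts.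
  move=> /(on_fiber_base (baseA i))[sc0 DA _].
  apply: (imult_local deltaF0 (Vcurve_homog false) (Vcurve_homog true)
    (c := iota (fiber_scale (A i))) (t := iota (fiber_coord (A i)))).
  - by rewrite fmorph_eq0.
  - move=> j; rewrite DA rmorphM /chart; congr (_ * _).
    by case: (val j) => [|[|]].
  exact: dim_ts.
rewrite (eq_bigr _ imultE); apply: sum_count_mem => [i j onAi onAj /fmorph_inj eqr|t ts_t].
  have [sci DAi _] := on_fiber_base (baseA i) onAi.
  have [scj DAj _] := on_fiber_base (baseA j) onAj.
  apply/eqP; apply: contraT => /eqP neij; case: (nprop_l i j) => //.
    by move=> /val_inj.
  exists (fiber_scale (A i) / fiber_scale (A j)) => m.
  by rewrite -/(A i) -/(A j) DAi DAj eqr mulrA divfK.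
(* If [V j] were nonzero at [(0, t)], the local ideal would be the whole ring and [t] would not
   occur in [ts]. *)
have zero j : ev0 t (dehomF (V j)) = 0.
  apply/eqP; apply: contraTT ts_t => nz; rewrite -has_pred1 has_count -leqNgt.
  have Ij : ideal2 (dehomF (V false)) (dehomF (V true)) (dehomF (V j)).
    case: (j); first by exists 0, 1; rewrite mul0r mul1r add0r.
    by exists 1, 0; rewrite mul0r mul1r addr0.
  have [e [freee _]] := dim_ts t.
  exact: loc_free_leq idI (loc_dim0 idI nz Ij) freee.
have [r Dr baser] := fiber_common_zero zero.
have [i lti [c Dc]] := all_l _ baser.
have onA : on_fiber (A (Ordinal lti)) by apply: chart_on_fiber Dc.
exists (Ordinal lti) => //; rewrite Dr; apply: (congr1 iota).
have [sc0 DA _] := on_fiber_base (baseA _) onA.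
rewrite /fiber_coord.
have E i' : chart a b r i' = c * fiber_scale (A (Ordinal lti))
    * chart a b (fiber_coord (A (Ordinal lti))) i'.
  by rewrite -mulrA -DA; apply: Dc.
have c1 : c * fiber_scale (A (Ordinal lti)) = 1.
  have [a0|a0] := eqVneq a 0.
    have b0 : b != 0 by apply: contra_neq delta0 => ->; rewrite a0 mul0r mulr0 subr0.
    by apply: (mulIf b0); rewrite mul1r -(E (@Ordinal 3 1 isT)).
  by apply: (mulIf a0); rewrite mul1r -(E ord0).
by have := E (@Ordinal 3 2 isT); rewrite c1 mul1r.
Qed.

End Chart.
End Fiber.

(** * Counting over the projective line *)

Section BinaryForms.

Variables (K : closedFieldType) (C : {mpoly K[2]}) (e : nat).
Hypotheses (C0 : C != 0) (hC : C \is e.-homog).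

Lemma mdeg2 (m : 'X_{1..2}) : mdeg m = (m ord0 + m ord_max)%N.
Proof.
rewrite mdegE big_ord_recl big_ord1; congr (_ + m _)%N; exact: val_inj.
Qed.

Definition form_right : {poly K} := mmap polyC (pair2 1 'X) C.
Definition form_left : {poly K} := mmap polyC (pair2 'X 1) C.

Lemma coef_form_right i :
  form_right`_i = \sum_(m <- msupp C) C@_m * (i == m ord_max)%:R.
Proof.
rewrite /form_right /mmap coef_sum; apply: eq_bigr => m _.
rewrite coefCM /mmap1 big_ord_recl big_ord1 /pair2 /= expr1n mul1r coefXn.
by rewrite (_ : lift _ _ = ord_max) //; apply: val_inj.
Qed.

Lemma coef_form_left i :
  form_left`_i = \sum_(m <- msupp C) C@_m * (i == m ord0)%:R.
Proof.
rewrite /form_left /mmap coef_sum; apply: eq_bigr => m _.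
by rewrite coefCM /mmap1 big_ord_recl big_ord1 /pair2 /= expr1n mulr1 coefXn.
Qed.

(** For a form of degree [e], the two dehomogenizations are reciprocal polynomials. *)
Lemma coef_form_rev i : (i <= e)%N -> form_left`_i = form_right`_(e - i).
Proof.
move=> lei; rewrite coef_form_left coef_form_right; apply: eq_big_seq => m.
move=> /(dhomogP _ _ _ hC) /=; rewrite mdeg2 => De.
by congr (_ * _%:R); apply/eqP/eqP; lia.
Qed.

Lemma size_form_right : (size form_right <= e.+1)%N.
Proof.
apply/leq_sizeP => i lti; rewrite coef_form_right big1_seq // => m /andP[_].
move=> /(dhomogP _ _ _ hC) /=; rewrite mdeg2 => De.
by rewrite (_ : (i == _) = false) ?mulr0 //; apply/eqP; lia.
Qed.

(** In a form, the exponent of [t_2] determines the monomial, so no terms merge when [t_1] is set to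
    1. *)
Lemma form_right_neq0 : form_right != 0.
Proof.
have suppC := mlead_supp C0; pose m := mlead C.
suff : form_right`_(m ord_max) != 0.
  by apply: contra_neq => ->; rewrite coef0.
rewrite coef_form_right (bigD1_seq m) ?msupp_uniq //= eqxx mulr1 big1_seq ?addr0.
  by rewrite -mcoeff_msupp.
move=> m' /andP[neq suppm']; rewrite (_ : (_ == _) = false) ?mulr0 //.
apply: contraNF neq => /eqP e1; apply/eqP/mnmP => i.
have /= := dhomogP _ _ _ hC _ suppC; rewrite -/m => Dm.
have /= := dhomogP _ _ _ hC _ suppm'; rewrite -Dm !mdeg2 e1 => /addIn e0.
by case: i => [[|[|//]] lti]; [rewrite (_ : Ordinal lti = ord0)
  | rewrite (_ : Ordinal lti = ord_max)] => //; apply: val_inj.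
Qed.

Lemma fiber_poly_right rho : fiber_poly 1 rho 0 1 C = form_right \Po ('X + rho%:P).
Proof.
pose c : {rmorphism K -> {poly K}} := polyC.
pose h : {rmorphism {poly K} -> {poly K}} := comp_poly ('X + rho%:P).
rewrite -[RHS]/(h (mmap c (pair2 1 'X) C)) (rmorph_mmap c h).
apply: eq_mmap => [x|[[|[|//]] lti]]; rewrite /= ?comp_polyC // /pair2 /=.
  by rewrite scale0r addr0.
by rewrite scale1r comp_polyX addrC.
Qed.

Lemma fiber_poly_left : fiber_poly 0 1 1 0 C = form_left.
Proof.
apply: eq_mmap => [x|[[|[|//]] lti]] //; rewrite /pair2 /=.
  by rewrite scale1r polyC0 add0r.
by rewrite scale0r addr0.
Qed.

Lemma prod_XsubC_comp (rs : seq K) rho :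
  exists2 q : {poly K},
    (\prod_(r <- rs) ('X - r%:P)) \Po ('X + rho%:P) = 'X^(count_mem rho rs) * q
    & q.[0] != 0.
Proof.
elim: rs => [|r rs [q Dq q0]].
  by exists 1; rewrite ?big_nil ?comp_polyC ?expr0 ?mulr1 // hornerC oner_eq0.
rewrite big_cons rmorphM /= Dq comp_polyB comp_polyX comp_polyC.
case: eqP => [->|/eqP neq].
  by exists q => //; rewrite addrK add1n exprS mulrA.
exists (('X + rho%:P - r%:P) * q); first by rewrite mulrCA.
by rewrite hornerM mulf_neq0 // !hornerE subr_eq0 eq_sym.
Qed.

(** The list [rs] consists of the roots of [C(1, X)], and [k] is the amount by which its degree
    falls short of [e]. This is the order at 0 of the reciprocal polynomial [C(X, 1)], that is, the
    multiplicity of the point [(0:1)]. *)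
Lemma binary_form_factor :
  exists (rs : seq K) k,
    [/\ (size rs + k = e)%N,
        forall rho, exists2 q, fiber_poly 1 rho 0 1 C = 'X^(count_mem rho rs) * q
                             & q.[0] != 0
      & exists2 q, fiber_poly 0 1 1 0 C = 'X^k * q & q.[0] != 0].
Proof.
have p0 := form_right_neq0.
have [rs Drs] := closed_field_poly_normal form_right.
have lc0 : lead_coef form_right != 0 by rewrite lead_coef_eq0.
have sz_rs : size form_right = (size rs).+1.
  by rewrite Drs size_scale // size_prod_XsubC.
have ler : (size rs <= e)%N by rewrite -ltnS -sz_rs size_form_right.
have lcE : form_right`_(size rs) = lead_coef form_right by rewrite lead_coefE sz_rs.
pose k := (e - size rs)%N.
have qk : form_left`_k != 0.
  by rewrite coef_form_rev ?leq_subr // /k subKn // lcE.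
have [m [q root_q Dq]] := multiplicity_XsubC form_left 0.
have q0 : form_left != 0 by apply: contra_neq qk => ->; rewrite coef0.
rewrite q0 /= in root_q; rewrite polyC0 subr0 in Dq.
have Dm : m = k.
  apply/eqP; rewrite eqn_leq; apply/andP; split.
    by apply: contraNleq qk => ltkm; rewrite Dq coefMXn ltkm.
  apply: contraNleq root_q => ltmk; rewrite /root horner_coef0.
  have -> : q`_0 = form_left`_m by rewrite Dq coefMXn ltnn subnn.
  rewrite coef_form_rev; last by apply: leq_trans (ltnW ltmk) (leq_subr _ _).
  by rewrite nth_default // sz_rs; move: ltmk; rewrite /k; lia.
exists rs, k; split; first by rewrite /k subnKC.
  move=> rho; have [r Dr r0] := prod_XsubC_comp rs rho.
  exists (lead_coef form_right *: r); last by rewrite hornerZ mulf_neq0.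
  by rewrite fiber_poly_right Drs comp_polyZ Dr -scalerAr lead_coefZ
    lead_coef_prod_XsubC mulr1.
by exists q; rewrite ?fiber_poly_left -?Dm 1?mulrC.
Qed.

Lemma deg_t_homog : deg_t C = e.
Proof. exact: dhomog_uniq C0 (dhomog_msize hC) hC. Qed.

End BinaryForms.

(** * Summation of the fibre contributions *)

Lemma exists_notin (K : closedFieldType) (rs : seq K) : exists x, x \notin rs.
Proof.
have /closed_nonrootP[x] : \prod_(r <- rs) ('X - r%:P) != 0.
  by rewrite monic_neq0 // monic_prod_XsubC.
by rewrite root_prod_XsubC; exists x.
Qed.

Theorem theorem3p3 (K : closedFieldType) (s : 'I_3 -> {mpoly K[3]}) (d : nat) :
  [pchar K] =i pred0 ->
  (forall i, s i \is d.-homog) ->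
  mcoprime3 s ->
  dominant s ->
  (forall i, (s i).@[e3] != 0) ->
  forall (F : closedFieldType) (iota : {rmorphism K -> F}) (z : 'I_6 -> F),
  alg_indep iota z ->
  forall l : seq ('I_3 -> K), base_points_reps s l ->
  forall M : 'M[K]_3, M \in unitmx ->
  forall C : {mpoly K[2]},
    is_content (resultant (VL s M false) (VL s M true)) C ->
    (\sum_(A <- l) imult (Vcurve iota z s false) (Vcurve iota z s true)
                          (fun j => iota (A j)))%N
    = deg_t C.
Proof.
move=> _ hs _ _ he3 F iota z z_indep l repl M uM C contC.
pose i1 : 'I_3 := @Ordinal 3 1 isT.
pose A (i : 'I_(size l)) := nth (fun=> 0) l i.
have baseA i : is_base_point s (A i) by apply: repl.1.
set RL := resultant _ _ in contC.
have [e hRL] : exists e, coef_homog e RL.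
  (* The size of [VL] does not depend on the chart; the one at [(1:0)] serves. *)
  have sz := size_VL hs he3 z_indep uM 1 0 0 1.
  by apply: (resultant_coef_homog (sz false) (sz true)); apply: graded_VL.
have delta_aff (rho : K) : 1 * 1 - 0 * rho != 0 by rewrite mul0r subr0 mulr1 oner_eq0.
have delta_inf : 0 * 0 - 1 * 1 != 0 :> K by rewrite mulr0 sub0r mulr1 oppr_eq0 oner_eq0.
pose ratio (B : 'I_3 -> K) := B i1 / B ord0.
have RL0 : RL != 0.
  (* The base points are finite in number, so some fibre over [(1:rho)] contains none, and the
     resultant is nonzero there. *)
  have [rho rho_l] := exists_notin [seq ratio (A i) | i : 'I_(size l)].
  have : (fiber_eval iota z M 1 rho 0 1 RL).[0] != 0.
    apply: (fiber_eval_neq0 hs he3 z_indep uM (delta_aff rho)) => r baser.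
    case/negP: rho_l; have [i lti [c Dc]] := repl.2.2 _ baser.
    apply/mapP; exists (Ordinal lti); rewrite ?mem_enum // /ratio /A /=.
    have := Dc ord0; have := Dc i1; rewrite /chart /= => -> D1.
    have c0 : c != 0 by apply: contraTneq (oner_neq0 K) => c0; rewrite D1 c0 mul0r eqxx.
    have A0 : nth (fun=> 0) l i ord0 = c^-1 by apply: (mulfI c0); rewrite -D1 mulfV.
    by rewrite A0 invrK mulrC.
  by apply: contra_neq => ->; rewrite (rmorph0 (fiber_eval _ _ _ _ _ _ _)) horner0.
have [R' DR] := content_factor contC.
have C0 := content_neq0 contC RL0.
have [n hC] := content_homog contC RL0 hRL.
rewrite (deg_t_homog C0 hC).
have [rs [k [sz_rs aff [qinf Dinf qinf0]]]] := binary_form_factor C0 hC.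
pose f i := imult (Vcurve iota z s false) (Vcurve iota z s true) (fun j => iota (A i j)).
have sum_aff rho : (\sum_(i | on_fiber 1 rho (A i)) f i)%N = count_mem rho rs.
  have [q Dq q0] := aff rho.
  have prim := content_primitive contC RL0 hRL DR (delta_aff rho).
  have [q' Dq' q'0] := fiber_eval_factor (z := z) z_indep uM DR prim Dq q0.
  exact: (fiber_sum hs he3 z_indep uM (delta_aff rho) repl Dq' q'0).
have sum_inf : (\sum_(i | on_fiber 0 1 (A i)) f i)%N = k.
  have prim := content_primitive contC RL0 hRL DR delta_inf.
  have [q' Dq' q'0] := fiber_eval_factor (z := z) z_indep uM DR prim Dinf qinf0.
  exact: (fiber_sum hs he3 z_indep uM delta_inf repl Dq' q'0).
have on_inf i : on_fiber 0 1 (A i) = (A i ord0 == 0).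
  by rewrite /on_fiber mulr0 mulr1.
have on_aff i rho : on_fiber 1 rho (A i) = (A i ord0 != 0) && (rho == ratio (A i)).
  rewrite /on_fiber mulr1 /ratio; have [A0|A0] := eqVneq (A i ord0) 0.
    rewrite A0 mul0r /= eq_sym; apply/negbTE.
    by have := base_point_neq_e3 hs he3 (baseA i); rewrite A0 eqxx.
  by rewrite /= -(inj_eq (mulfI A0) rho) mulrCA mulfV ?mulr1.
(* [S] contains the slopes of the affine zeros of the content and of the base points, so that both
   sides can be summed over it. *)
pose S := undup (rs ++ [seq ratio (A i) | i : 'I_(size l)]).
rewrite (big_nth (fun=> 0)) big_mkord (bigID (fun i => A i ord0 == 0)) /=.
rewrite (eq_bigl _ _ (fun i => esym (on_inf i))) sum_inf -sz_rs addnC; congr (_ + _)%N.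
have <- : (\sum_(rho <- S) count_mem rho rs = size rs)%N.
  apply: sum_count_uniq; first exact: undup_uniq.
  by move=> r r_rs; rewrite mem_undup mem_cat r_rs.
under [RHS]eq_bigr => rho _ do rewrite -sum_aff.
(* A base point with nonzero first coordinate lies on exactly one of these fibres, that of slope
   [ratio (A i)]. *)
rewrite (exchange_big_dep (fun i => A i ord0 != 0)) /=; last first.
  by move=> rho i _; rewrite on_aff => /andP[].
apply: eq_bigr => i A0; rewrite -big_filter.
rewrite (_ : filter _ _ = [:: ratio (A i)]) ?big_seq1 //.
rewrite (eq_filter (a2 := pred1 (ratio (A i)))) => [|rho]; last by rewrite on_aff A0.
rewrite filter_pred1_uniq ?undup_uniq // mem_undup mem_cat.
by rewrite (map_f (fun i => ratio (A i))) ?mem_enum ?orbT.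
Qed.
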